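(* Let $S=Conv_{L^{0}}(\{x_{1},x_{2},\cdots,x_{n}\})$ be an $(n-1)$-dimensional $L^{0}$-simplex in a regular $L^{0}$-module $E$, $\mathscr{S}$ an $L^{0}$-simplicial subdivision of $S$ and $\phi$ a proper $L^{0}$-labeling function of $\mathscr{S}$. Then there exist a finite family $\{S_{m}:=Conv_{L^{0}}(\{y_{1}^{m},y_{2}^{m},\cdots,y_{n}^{m}\}): m=1,\dots,M\}$ of $(n-1)$-dimensional $L^{0}$-simplexes in $\mathscr{S}$ and $\{a_{m}: m=1,\dots,M\}\in p(1)$ such that $$\sum_{m=1}^{M}I_{a_{m}}S_{m}=Conv_{L^{0}}\Big(\Big\{\sum_{m=1}^{M}I_{a_{m}}y_{1}^{m}, \sum_{m=1}^{M}I_{a_{m}}y_{2}^{m},\cdots, \sum_{m=1}^{M}I_{a_{m}}y_{n}^{m}\Big\}\Big)$$ is an $(n-1)$-dimensional $L^{0}$-simplex completely labeled by $\phi$ and satisfies $$\phi\Big(\sum_{m=1}^{M}I_{a_{m}}y_{j}^{m}\Big)=j\quad\text{for any } j\in\{1,2,\cdots,n\}.$$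
   Context: Let $(\Omega,\mathcal{F},P)$ be a probability space and $\mathbb{K}=\mathbb{R}$ or $\mathbb{C}$. $L^0(\mathcal{F},\mathbb{K})$ is the algebra of a.s.-equivalence classes of $\mathbb{K}$-valued random variables; $L^0(\mathcal{F})=L^0(\mathcal{F},\mathbb{R})$ has the a.s. order, $L^0_+(\mathcal{F})=\{\xi\in L^0(\mathcal{F}):\xi\ge0\}$. For a separable metric space $M$ (e.g. $\{1,\dots,n\}$ or $(0,1)$), $L^0(\mathcal{F},M)$ is the set of equivalence classes of $M$-valued measurable functions. $B_{\mathcal{F}}$ is the measure algebra ($\mathcal{F}$ modulo null sets), a complete Boolean algebra with $1=[\Omega]$, $0=[\emptyset]$; for $a=[A]\in B_{\mathcal{F}}$, $I_a$ is the class of the indicator of $A$. $(\xi=\eta)\in B_{\mathcal{F}}$ is the class of the event where representatives of $\xi,\eta$ agree (similarly for $<,\le$). $p(1)$ is the collection of partitions of unity of $B_{\mathcal{F}}$ (families of pairwise disjoint elements, possibly $0$, with supremum $1$). An $L^0$-module is a left module $E$ over $L^0(\mathcal{F},\mathbb{K})$ (also a linear space over $\mathbb{K}$); it is regular if $x=y$ whenever $I_{a_n}x=I_{a_n}y$ for all $n$ for some $\{a_n,n\in\mathbb{N}\}\in p(1)$. A nonempty $G\subseteq E$ is $\sigma$-stable if for each sequence $\{x_n\}$ in $G$ and $\{a_n\}\in p(1)$ there is $x\in G$ with $I_{a_n}x=I_{a_n}x_n$ for all $n$; this unique $x$ is written $\sum_n I_{a_n}x_n$. If $G$ is $\sigma$-stable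 and $\emptyset\ne H\subseteq G$, $\sigma(H)=\{\sum_n I_{a_n}h_n: h_n\in H,\{a_n\}\in p(1)\}$. For subsets $G_n$ of a $\sigma$-stable set, $\sum_n I_{a_n}G_n=\{\sum_n I_{a_n}x_n:x_n\in G_n\}$ (analogously for finite partitions). A mapping $f$ between $\sigma$-stable sets is $\sigma$-stable if $f(\sum_n I_{a_n}x_n)=\sum_n I_{a_n}f(x_n)$ always. $Conv_{L^0}(G)=\{\sum_{i=1}^k\xi_i x_i:k\in\mathbb{N},x_i\in G,\xi_i\in L^0_+(\mathcal{F}),\sum_i\xi_i=1\}$. $\{x_1,\dots,x_n\}\subseteq E$ is $L^0$-affinely independent if $n=1$, or $n>1$ and $\{x_i-x_1:2\le i\le n\}$ is $L^0$-linearly independent ($\sum\xi_i(x_i-x_1)=0$ with $\xi_i\in L^0(\mathcal{F},\mathbb{K})$ implies all $\xi_i=0$). Then $S=Conv_{L^0}(\{x_1,\dots,x_n\})$ is an $(n-1)$-dimensional $L^0$-simplex with vertices $x_1,\dots,x_n$ (an $L^0$-simplex is always considered together with its given vertices); its $L^0$-faces are the sets $Conv_{L^0}(\{x_i:i\in I\})$, $\emptyset\neq I\subseteq\{1,\dots,n\}$. Such $S$ is $\sigma$-stable and each $x\in S$ is uniquely $\sum_i\xi_ix_i$ with $\xi_i\in L^0_+(\mathcal{F})$, $\sum_i\xi_i=1$. Its associated simplex is the classical simplex $S'=Conv(\{x_1,\dots,x_n\})$ (usual convex hull). A simplicial subdivision of a classical $(n-1)$-dimensional simplex $S'$ is a finite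 family $\mathscr{S}'$ of $(n-1)$-dimensional simplexes with $S'=\bigcup\mathscr{S}'$ such that any two members have intersection empty or a common face of both. A finite family $\mathscr{S}$ of $(n-1)$-dimensional $L^0$-simplexes is an $L^0$-simplicial subdivision of $S$ if (1) $S=\sigma(\bigcup\mathscr{S})$; (2) for $S_1,S_2\in\mathscr{S}$, $S_1\cap S_2$ is empty or a common $L^0$-face of $S_1$ and $S_2$; (3) $\mathscr{S}'=\{G':G\in\mathscr{S}\}$ is a simplicial subdivision of $S'$. A point $h\in G$ is an $L^0$-extreme point of $G$ if $x,y\in G$ and $\lambda x+(1-\lambda)y=h$ for some $\lambda\in L^0(\mathcal{F},(0,1))$ imply $x=y=h$; $ext_{L^0}(G)$ is the set of these, and $ext_{L^0}(\mathscr{S})=\sigma[\bigcup_{G\in\mathscr{S}}ext_{L^0}(G)]$. An $L^0$-labeling function of $\mathscr{S}$ is a $\sigma$-stable mapping $\phi:ext_{L^0}(\mathscr{S})\to L^0(\mathcal{F},\{1,\dots,n\})$. It is proper if $(\phi(y)=i)\wedge(\lambda_i=0)=0$ for all $y=\sum_{i=1}^n\lambda_ix_i\in ext_{L^0}(\mathscr{S})$ (with $\lambda_i\in L^0_+(\mathcal{F})$, $\sum_i\lambda_i=1$) and all $i$. An $L^0$-simplex $Conv_{L^0}(\{y_1,\dots,y_n\})$ with all $y_j\in ext_{L^0}(\mathscr{S})$ is completely labeled by $\phi$ if $\phi$ is a proper $L^0$-labeling function of $\mathscr{S}$ and $\{\phi(y_j):1\le j\le n\}=\{1,\dots,n\}$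 (as classes of constants). *)

(* Defs.v *)
From HB Require Import structures.
From mathcomp Require Import all_boot all_order all_algebra.
From mathcomp Require Import complex.
From mathcomp Require Import all_classical all_reals all_analysis.
From mathcomp Require Import measurable_realfun.

Set Implicit Arguments.
Unset Strict Implicit.
Unset Printing Implicit Defensive.

Import Order.TTheory GRing.Theory Num.Theory numFieldNormedType.Exports.

Local Open Scope classical_set_scope.
Local Open Scope ring_scope.
Local Open Scope quotient_scope.

(* Measurable spaces in which {x = y} is measurable for measurable x, y; every
   separable metric space with its Borel sets is one. *)
HB.mixin Record hasMeasurableDiag d M & Measurable d M := {
  measurable_diag : measurable [set p : M * M | p.1 = p.2]
}.

#[short(type="diagMeasurableType")]
HB.structure Definition DiagMeasurable d :=
  {M of Measurable d M & hasMeasurableDiag d M}.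

Section RealScalars.
Context (R : realType).

Let measurable_diagR : measurable [set p : R * R | p.1 = p.2].
Proof.
have -> : [set p : R * R | p.1 = p.2] = setT `&` (fst \- snd) @^-1` [set 0].
  apply/seteqP; split=> p /=; first by move=> ->; rewrite subrr.
  by case=> _ /eqP; rewrite subr_eq0 => /eqP.
exact: (measurable_funB (@measurable_fst _ _ R R) (@measurable_snd _ _ R R)).
Qed.

HB.instance Definition _ :=
  @hasMeasurableDiag.Build default_measure_display R measurable_diagR.

End RealScalars.

Section ComplexScalars.
Context (R : realType).

Definition complex_of_pair (p : R * R) : R[i] := (p.1 +i* p.2)%C.

Lemma complex_of_pairK (z : R[i]) : complex_of_pair (complex.Re z, complex.Im z) = z.
Proof. by case: z. Qed.

(* The Borel sets of R[i] = R^2; see measurable_complexP. *)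
Definition complex_measurable : set (set R[i]) :=
  image_set_system setT complex_of_pair measurable.

Let sigma_complex : sigma_algebra setT complex_measurable.
Proof. exact/sigma_algebra_image/sigma_algebra_measurable. Qed.

Let complex_measurable0 : complex_measurable set0.
Proof. by case: sigma_complex. Qed.

Let complex_measurableC A : complex_measurable A -> complex_measurable (~` A).
Proof. by case: sigma_complex => _ h _ /h; rewrite setTD. Qed.

Let complex_measurableU (F : (set R[i])^nat) :
  (forall i, complex_measurable (F i)) -> complex_measurable (\bigcup_i F i).
Proof. by case: sigma_complex => _ _; apply. Qed.

HB.instance Definition _ := isPointed.Build R[i] 0.

HB.instance Definition _ := @isMeasurable.Build default_measure_display R[i]
  complex_measurable complex_measurable0 complex_measurableC
  complex_measurableU.

Lemma measurable_complexP d (T : measurableType d) (f : T -> R[i]) :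
  measurable_fun setT f <->
  measurable_fun setT (fun t => complex.Re (f t)) /\
  measurable_fun setT (fun t => complex.Im (f t)).
Proof.
have mRe : measurable_fun setT (@complex.Re R : R[i] -> R).
  move=> _ B mB; rewrite setTI /measurable /= /complex_measurable.
  exact: measurable_fst.
have mIm : measurable_fun setT (@complex.Im R : R[i] -> R).
  move=> _ B mB; rewrite setTI /measurable /= /complex_measurable.
  exact: measurable_snd.
have mC : measurable_fun setT complex_of_pair by move=> _ B.
split=> [mf|[mr mi]]; first by split; exact: measurableT_comp.
have -> : f = complex_of_pair \o (fun t => (complex.Re (f t), complex.Im (f t))).
  by apply/funext => t; rewrite /= complex_of_pairK.
by apply: measurableT_comp => //; exact: measurable_fun_pair.
Qed.

Let measurable_ReIm : measurable_fun setT (@complex.Re R : R[i] -> R) /\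
  measurable_fun setT (@complex.Im R : R[i] -> R).
Proof. exact/(measurable_complexP (fun z => z)). Qed.

Let mRe1 : measurable_fun setT (fun p : R[i] * R[i] => complex.Re p.1).
Proof. by apply: measurableT_comp => //; case: measurable_ReIm. Qed.
Let mIm1 : measurable_fun setT (fun p : R[i] * R[i] => complex.Im p.1).
Proof. by apply: measurableT_comp => //; case: measurable_ReIm. Qed.
Let mRe2 : measurable_fun setT (fun p : R[i] * R[i] => complex.Re p.2).
Proof. by apply: measurableT_comp => //; case: measurable_ReIm. Qed.
Let mIm2 : measurable_fun setT (fun p : R[i] * R[i] => complex.Im p.2).
Proof. by apply: measurableT_comp => //; case: measurable_ReIm. Qed.

Let measurable_diagC : measurable [set p : R[i] * R[i] | p.1 = p.2].
Proof.
have -> : [set p : R[i] * R[i] | p.1 = p.2] =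
    (setT `&` (fun p => (complex.Re p.1, complex.Re p.2)) @^-1` [set q : R * R | q.1 = q.2])
    `&` (setT `&` (fun p => (complex.Im p.1, complex.Im p.2)) @^-1` [set q | q.1 = q.2]).
  apply/seteqP; split=> [[[a b] [c e]] /= [-> ->] //|].
  by move=> [[a b] [c e]] /= [[_ ->] [_ ->]].
by apply: measurableI; apply: measurable_fun_pair => //; exact: measurable_diag.
Qed.

HB.instance Definition _ :=
  @hasMeasurableDiag.Build default_measure_display R[i] measurable_diagC.

Lemma measurable_complex_add : measurable_fun setT (fun p : R[i] * R[i] => p.1 + p.2).
Proof.
apply/measurable_complexP; split.
  rewrite [X in measurable_fun _ X](_ : _ = fun p => complex.Re p.1 + complex.Re p.2).
    exact: measurable_funD.
  by apply/funext => -[[a b] [c e]].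
rewrite [X in measurable_fun _ X](_ : _ = fun p => complex.Im p.1 + complex.Im p.2).
  exact: measurable_funD.
by apply/funext => -[[a b] [c e]].
Qed.

Lemma measurable_complex_opp : measurable_fun setT (fun p : R[i] => - p).
Proof.
have [mRe mIm] := measurable_ReIm.
apply/measurable_complexP; split.
  rewrite [X in measurable_fun _ X](_ : _ = fun p => - complex.Re p).
    exact: measurableT_comp.
  by apply/funext => -[].
rewrite [X in measurable_fun _ X](_ : _ = fun p => - complex.Im p).
  exact: measurableT_comp.
by apply/funext => -[].
Qed.

Lemma measurable_complex_mul : measurable_fun setT (fun p : R[i] * R[i] => p.1 * p.2).
Proof.
apply/measurable_complexP; split.
  rewrite [X in measurable_fun _ X]
    (_ : _ = fun p => complex.Re p.1 * complex.Re p.2 - complex.Im p.1 * complex.Im p.2).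
    by apply: measurable_funB; exact: measurable_funM.
  by apply/funext => -[[a b] [c e]].
rewrite [X in measurable_fun _ X]
  (_ : _ = fun p => complex.Re p.1 * complex.Im p.2 + complex.Im p.1 * complex.Re p.2).
  by apply: measurable_funD; exact: measurable_funM.
by apply/funext => -[[a b] [c e]].
Qed.

End ComplexScalars.

Inductive scalar_kind := RealScalars | ComplexScalars.

Definition scalar_field (R : realType) (k : scalar_kind) : numFieldType :=
  match k with
  | RealScalars => R
  | ComplexScalars => R[i]
  end.

Definition scalars (R : realType) (k : scalar_kind) : Type := scalar_field R k.

Section Scalars.
Context (R : realType) (k : scalar_kind).
Local Notation K := (scalars R k).

HB.instance Definition _ := Num.NumField.on K.
HB.instance Definition _ := isPointed.Build K 0.

Definition scalars_measurable : set (set K) :=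
  match k return set (set (scalars R k)) with
  | RealScalars => (measurable : set (set R))
  | ComplexScalars => (measurable : set (set R[i]))
  end.

Let scalars_measurable0 : scalars_measurable set0.
Proof. by rewrite /scalars_measurable; case: k; exact: measurable0. Qed.

Let scalars_measurableC A : scalars_measurable A -> scalars_measurable (~` A).
Proof.
by move: A; rewrite /scalars_measurable; case: k => A; exact: measurableC.
Qed.

Let scalars_measurableU (F : (set K)^nat) :
  (forall i, scalars_measurable (F i)) -> scalars_measurable (\bigcup_i F i).
Proof.
by move: F; rewrite /scalars_measurable; case: k => F; exact: bigcupT_measurable.
Qed.

HB.instance Definition _ := @isMeasurable.Build default_measure_display K
  scalars_measurable scalars_measurable0 scalars_measurableC
  scalars_measurableU.

End Scalars.

Section ScalarOperations.
Context (R : realType) (k : scalar_kind).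
Local Notation K := (scalars R k).

Let measurable_diagK : measurable [set p : K * K | p.1 = p.2].
Proof.
case: k; [exact: (@measurable_diag _ R)|exact: (@measurable_diag _ R[i])].
Qed.

HB.instance Definition _ :=
  @hasMeasurableDiag.Build default_measure_display K measurable_diagK.

Lemma measurable_scalars_add : measurable_fun setT (fun p : K * K => p.1 + p.2).
Proof.
case: k; last exact: (@measurable_complex_add R).
exact: (measurable_funD (@measurable_fst _ _ R R) (@measurable_snd _ _ R R)).
Qed.

Lemma measurable_scalars_opp : measurable_fun setT (fun p : K => - p).
Proof.
by case: k; [exact: (@oppr_measurable R setT)|exact: (@measurable_complex_opp R)].
Qed.

Lemma measurable_scalars_mul : measurable_fun setT (fun p : K * K => p.1 * p.2).
Proof.
case: k; last exact: (@measurable_complex_mul R).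
exact: (measurable_funM (@measurable_fst _ _ R R) (@measurable_snd _ _ R R)).
Qed.

End ScalarOperations.

Section Labels.
Context (n : nat).

HB.instance Definition _ := isPointed.Build 'I_n.+1 ord0.

HB.instance Definition _ := @isMeasurable.Build default_measure_display
  'I_n.+1 discrete_measurable discrete_measurable0
  discrete_measurableC discrete_measurableU.

Let measurable_diagI : measurable [set p : 'I_n.+1 * 'I_n.+1 | p.1 = p.2].
Proof.
have -> : [set p : 'I_n.+1 * 'I_n.+1 | p.1 = p.2] =
    \bigcup_(i in [set: 'I_n.+1]) ([set i] `*` [set i]).
  apply/seteqP; split=> [[i j] /= <-|[i j] [k _ /= [-> ->]] //].
  by exists i.
by apply: fin_bigcup_measurable => // i _; exact: measurableX.
Qed.

HB.instance Definition _ :=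
  @hasMeasurableDiag.Build default_measure_display 'I_n.+1 measurable_diagI.

End Labels.

Section MeasureAlgebra.
Context d (Omega : measurableType d) (R : realType) (P : probability Omega R).

Definition null_diff (A B : {A : set Omega | A \in @measurable d Omega}) : bool :=
  P (sval A `+` sval B) == 0%E.

Let null_diffP A B :
  reflect (sval A = sval B %[ae P]) (null_diff A B).
Proof.
have mA := set_mem (svalP A); have mB := set_mem (svalP B).
have mAB : measurable (sval A `+` sval B) by apply: measurableU; apply: measurableD.
have eAB : sval A `+` sval B = ~` [set w | setT w -> sval A w = sval B w].
  apply/seteqP; split=> [w [[Aw nBw]|[Bw nAw]] /= /(_ I) e|w /= ne].
  - by apply: nBw; rewrite -e.
  - by apply: nAw; rewrite e.
  - have [Aw|nAw] := pselect (sval A w); have [Bw|nBw] := pselect (sval B w).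
    + by exfalso; apply: ne => _; apply/propext.
    + by left; split.
    + by right; split.
    + by exfalso; apply: ne => _; apply/propext; split.
apply: (iffP eqP) => [e0|[N [mN N0 sN]]].
  by exists (sval A `+` sval B); split => //; rewrite eAB.
apply: (subset_measure0 mAB mN _ N0).
by rewrite eAB.
Qed.

Let null_diff_equiv : equiv_class_of null_diff.
Proof.
split=> [A|A B|B A C].
- exact/null_diffP/ae_eq_refl.
- by apply/idP/idP => /null_diffP h; apply/null_diffP/ae_eq_sym.
- by move=> /null_diffP h1 /null_diffP h2; apply/null_diffP/(ae_eq_trans h1).
Qed.

Canonical null_diff_equivRel := EquivRelPack null_diff_equiv.

Definition measure_algebra : Type := {eq_quot null_diff}.
HB.instance Definition _ := Choice.on measure_algebra.
HB.instance Definition _ := EqQuotient.on measure_algebra.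

Definition event_class (A : set Omega) (mA : measurable A) : measure_algebra :=
  \pi_measure_algebra (exist _ A (mem_set mA)).

Definition event_repr (a : measure_algebra) : set Omega := sval (repr a).

Lemma measurable_event_repr a : measurable (event_repr a).
Proof. exact: set_mem (svalP (repr a)). Qed.

Lemma event_class_eqP A B (mA : measurable A) (mB : measurable B) :
  event_class mA = event_class mB <-> (A = B %[ae P]).
Proof.
split=> [/eqmodP/null_diffP //|h].
exact/eqmodP/null_diffP.
Qed.

Lemma event_reprK a (m : measurable (event_repr a)) : event_class m = a.
Proof.
rewrite -[RHS]reprK /event_class; congr (\pi _).
exact/val_inj.
Qed.

Lemma event_reprE A (mA : measurable A) :
  event_repr (event_class mA) = A %[ae P].
Proof.
apply/(event_class_eqP (measurable_event_repr _) mA).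
exact: event_reprK.
Qed.

Implicit Types a b c : measure_algebra.

Lemma event_repr_inj a b : event_repr a = event_repr b %[ae P] -> a = b.
Proof.
move=> /(event_class_eqP (measurable_event_repr a) (measurable_event_repr b)).
by rewrite !event_reprK.
Qed.

Definition ma_meet a b : measure_algebra := event_class
  (measurableI _ _ (measurable_event_repr a) (measurable_event_repr b)).
Definition ma_join a b : measure_algebra := event_class
  (measurableU _ _ (measurable_event_repr a) (measurable_event_repr b)).
Definition ma_compl a : measure_algebra :=
  event_class (measurableC (measurable_event_repr a)).
Definition ma_bot : measure_algebra := event_class measurable0.
Definition ma_top : measure_algebra := event_class measurableT.

Lemma ma_meetE a b :
  event_repr (ma_meet a b) = event_repr a `&` event_repr b %[ae P].
Proof. exact: event_reprE. Qed.
Lemma ma_joinE a b :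
  event_repr (ma_join a b) = event_repr a `|` event_repr b %[ae P].
Proof. exact: event_reprE. Qed.
Lemma ma_complE a : event_repr (ma_compl a) = ~` event_repr a %[ae P].
Proof. exact: event_reprE. Qed.

Let cI (A B C D : set Omega) : A = B %[ae P] -> C = D %[ae P] ->
  A `&` C = B `&` D %[ae P].
Proof.
move=> h1 h2; near=> w => _.
have e1 : A w = B w by near: w; apply: filterS h1 => w; exact.
have e2 : C w = D w by near: w; apply: filterS h2 => w; exact.
by rewrite /setI /mkset e1 e2.
Unshelve. all: by end_near. Qed.

Let cU (A B C D : set Omega) : A = B %[ae P] -> C = D %[ae P] ->
  A `|` C = B `|` D %[ae P].
Proof.
move=> h1 h2; near=> w => _.
have e1 : A w = B w by near: w; apply: filterS h1 => w; exact.
have e2 : C w = D w by near: w; apply: filterS h2 => w; exact.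
by rewrite /setU /mkset e1 e2.
Unshelve. all: by end_near. Qed.

Let tr (A B C : set Omega) : A = B %[ae P] -> B = C %[ae P] -> A = C %[ae P].
Proof. exact: ae_eq_trans. Qed.
Let sy (A B : set Omega) : A = B %[ae P] -> B = A %[ae P].
Proof. exact: ae_eq_sym. Qed.
Let rf (A : set Omega) : A = A %[ae P]. Proof. exact: ae_eq_refl. Qed.
Let eqe (A B : set Omega) : A = B -> A = B %[ae P]. Proof. by move=> ->. Qed.

Let meetC : commutative ma_meet.
Proof.
move=> a b; apply: event_repr_inj; apply: (tr (ma_meetE _ _)).
by apply: (tr _ (sy (ma_meetE _ _))); apply: eqe; rewrite setIC.
Qed.

Let joinC : commutative ma_join.
Proof.
move=> a b; apply: event_repr_inj; apply: (tr (ma_joinE _ _)).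
by apply: (tr _ (sy (ma_joinE _ _))); apply: eqe; rewrite setUC.
Qed.

Let meetA : associative ma_meet.
Proof.
move=> a b c; apply: event_repr_inj; apply: (tr (ma_meetE _ _)).
apply: (tr _ (sy (ma_meetE _ _))); apply: (tr (cI (rf _) (ma_meetE _ _))).
by apply: (tr _ (sy (cI (ma_meetE _ _) (rf _)))); apply: eqe; rewrite setIA.
Qed.

Let joinA : associative ma_join.
Proof.
move=> a b c; apply: event_repr_inj; apply: (tr (ma_joinE _ _)).
apply: (tr _ (sy (ma_joinE _ _))); apply: (tr (cU (rf _) (ma_joinE _ _))).
by apply: (tr _ (sy (cU (ma_joinE _ _) (rf _)))); apply: eqe; rewrite setUA.
Qed.

Let joinKI b a : ma_meet a (ma_join a b) = a.
Proof.
apply: event_repr_inj; apply: (tr (ma_meetE _ _)).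
by apply: (tr (cI (rf _) (ma_joinE _ _))); apply: eqe; rewrite setIC setUK.
Qed.

Let meetKU b a : ma_join a (ma_meet a b) = a.
Proof.
apply: event_repr_inj; apply: (tr (ma_joinE _ _)).
by apply: (tr (cU (rf _) (ma_meetE _ _))); apply: eqe; rewrite setUC setIK.
Qed.

Let meetUl : left_distributive ma_meet ma_join.
Proof.
move=> a b c; apply: event_repr_inj; apply: (tr (ma_meetE _ _)).
apply: (tr _ (sy (ma_joinE _ _))); apply: (tr (cI (ma_joinE _ _) (rf _))).
apply: (tr _ (sy (cU (ma_meetE _ _) (ma_meetE _ _)))).
by apply: eqe; rewrite setIUl.
Qed.

Let meetxx : idempotent_op ma_meet.
Proof.
move=> a; apply: event_repr_inj; apply: (tr (ma_meetE _ _)).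
by apply: eqe; rewrite setIid.
Qed.

Fact ma_display : Order.disp_t. Proof. exact: Order.default_display. Qed.

HB.instance Definition _ := @Order.isMeetJoinDistrLattice.Build ma_display
  measure_algebra (fun a b => ma_meet a b == a)
  (fun a b => (b != a) && (ma_meet a b == a)) ma_meet ma_join
  (fun _ _ => erefl) (fun _ _ => erefl)
  meetC joinC meetA joinA joinKI meetKU meetUl meetxx.

Let le0x a : (ma_bot <= a)%O.
Proof.
apply/eqP/event_repr_inj; apply: (tr (ma_meetE _ _)).
apply: (tr (cI (event_reprE _) (rf _))); apply: (tr _ (sy (event_reprE _))).
by apply: eqe; rewrite set0I.
Qed.

Let lex1 a : (a <= ma_top)%O.
Proof.
apply/eqP/event_repr_inj; apply: (tr (ma_meetE _ _)).
by apply: (tr (cI (rf _) (event_reprE _))); apply: eqe; rewrite setIT.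
Qed.

HB.instance Definition _ :=
  @Order.hasBottom.Build ma_display measure_algebra ma_bot le0x.
HB.instance Definition _ :=
  @Order.hasTop.Build ma_display measure_algebra ma_top lex1.

Let joinxC a : (a `|` ma_compl a)%O = \top%O.
Proof.
apply: event_repr_inj; apply: (tr (ma_joinE _ _)).
apply: (tr (cU (rf _) (ma_complE _))); apply: (tr _ (sy (event_reprE _))).
by apply: eqe; rewrite setUv.
Qed.

Let meetxC a : (a `&` ma_compl a)%O = \bot%O.
Proof.
apply: event_repr_inj; apply: (tr (ma_meetE _ _)).
apply: (tr (cI (rf _) (ma_complE _))); apply: (tr _ (sy (event_reprE _))).
by apply: eqe; rewrite setICr.
Qed.

HB.instance Definition _ := @Order.TBDistrLattice_hasComplement.Build ma_display
  measure_algebra ma_compl joinxC meetxC.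

(* The second conjunct says that the supremum of the family is \top. *)
Definition partition_of_unity (I : Type) (a : I -> measure_algebra) : Prop :=
  (forall i j, i <> j -> (a i `&` a j = \bot)%O) /\
  (forall b, (forall i, (a i <= b)%O) -> (b = \top)%O).

End MeasureAlgebra.

Section L0.
Context d (Omega : measurableType d) (R : realType) (P : probability Omega R).

Definition L0 d' (M : measurableType d') : Type := {mfun_ P, Omega >-> M}.

Section AnyTarget.
Context d' (M : measurableType d').

HB.instance Definition _ := Choice.on (L0 M).

Definition L0_class (f : Omega -> M) (mf : measurable_fun setT f) : L0 M :=
  \pi_{mfun_ P, Omega >-> M} (mfun_Sub (mem_set mf)).

Definition L0_const (c : M) : L0 M := L0_class (measurable_cst c).

Definition L0_repr (xi : L0 M) : Omega -> M := repr (xi : {mfun_ P, Omega >-> M}).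

Lemma measurable_L0_repr (xi : L0 M) : measurable_fun setT (L0_repr xi).
Proof. exact: measurable_funPT. Qed.

Lemma L0_class_eqP f g (mf : measurable_fun setT f) (mg : measurable_fun setT g) :
  L0_class mf = L0_class mg <-> (f = g %[ae P]).
Proof.
split=> [/eqmodP/asboolP //|h].
exact/eqmodP/asboolP.
Qed.

Lemma L0_reprK (xi : L0 M) (m : measurable_fun setT (L0_repr xi)) :
  L0_class m = xi.
Proof.
rewrite -[RHS](@reprK _ ({mfun_ P, Omega >-> M})) /L0_class; congr (\pi _).
exact/val_inj.
Qed.

Lemma L0_reprE f (mf : measurable_fun setT f) :
  L0_repr (L0_class mf) = f %[ae P].
Proof. by apply/(L0_class_eqP (measurable_L0_repr _) mf); exact: L0_reprK. Qed.

Lemma L0_repr_inj (xi eta : L0 M) : L0_repr xi = L0_repr eta %[ae P] -> xi = eta.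
Proof.
move=> /(L0_class_eqP (measurable_L0_repr xi) (measurable_L0_repr eta)).
by rewrite !L0_reprK.
Qed.

(* L^0(F, Q) for a subset Q of M, as a subset of L^0(F, M) *)
Definition L0_in (Q : set M) : set (L0 M) :=
  [set xi | {ae P, forall w, Q (L0_repr xi w)}].

End AnyTarget.

Section EqualityEvent.
Context d' (M : diagMeasurableType d').

Lemma measurable_eq_event (xi eta : L0 M) :
  measurable [set w | L0_repr xi w = L0_repr eta w].
Proof.
have mp : measurable_fun setT (fun w => (L0_repr xi w, L0_repr eta w)).
  by apply: measurable_fun_pair; exact: measurable_L0_repr.
by have := mp measurableT _ (@measurable_diag _ M); rewrite setTI.
Qed.

Definition L0_eq_event (xi eta : L0 M) : measure_algebra P :=
  event_class P (measurable_eq_event xi eta).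

End EqualityEvent.

Section Ring.
Context (k : scalar_kind).
Local Notation K := (scalars R k).
Implicit Types xi eta zeta : L0 K.

Let measurable_add_repr xi eta :
  measurable_fun setT (fun w => L0_repr xi w + L0_repr eta w).
Proof.
apply: (measurableT_comp (@measurable_scalars_add R k)
  (measurable_fun_pair (measurable_L0_repr xi) (measurable_L0_repr eta))).
Qed.

Let measurable_opp_repr xi : measurable_fun setT (fun w => - L0_repr xi w).
Proof.
exact: (measurableT_comp (@measurable_scalars_opp R k) (measurable_L0_repr xi)).
Qed.

Let measurable_mul_repr xi eta :
  measurable_fun setT (fun w => L0_repr xi w * L0_repr eta w).
Proof.
exact: (measurableT_comp (@measurable_scalars_mul R k)
  (measurable_fun_pair (measurable_L0_repr xi) (measurable_L0_repr eta))).
Qed.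

Definition L0_add xi eta : L0 K := L0_class (measurable_add_repr xi eta).
Definition L0_opp xi : L0 K := L0_class (measurable_opp_repr xi).
Definition L0_mul xi eta : L0 K := L0_class (measurable_mul_repr xi eta).

Let addE xi eta :
  {ae P, forall w, L0_repr (L0_add xi eta) w = L0_repr xi w + L0_repr eta w}.
Proof. by apply: filterS (L0_reprE (measurable_add_repr xi eta)) => w; exact. Qed.
Let oppE xi : {ae P, forall w, L0_repr (L0_opp xi) w = - L0_repr xi w}.
Proof. by apply: filterS (L0_reprE (measurable_opp_repr xi)) => w; exact. Qed.
Let mulE xi eta :
  {ae P, forall w, L0_repr (L0_mul xi eta) w = L0_repr xi w * L0_repr eta w}.
Proof. by apply: filterS (L0_reprE (measurable_mul_repr xi eta)) => w; exact. Qed.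
Let constE (c : K) : {ae P, forall w, L0_repr (L0_const c) w = c}.
Proof. by apply: filterS (L0_reprE (measurable_cst c)) => w; exact. Qed.

Let filterS4 (A B C D Q : Omega -> Prop) :
  (forall w, A w -> B w -> C w -> D w -> Q w) ->
  {ae P, forall w, A w} -> {ae P, forall w, B w} -> {ae P, forall w, C w} ->
  {ae P, forall w, D w} -> {ae P, forall w, Q w}.
Proof.
move=> h hA hB hC hD; near=> w; apply: h; near: w.
- exact: hA.
- exact: hB.
- exact: hC.
- exact: hD.
Unshelve. all: by end_near. Qed.

Let filterS5 (A B C D F Q : Omega -> Prop) :
  (forall w, A w -> B w -> C w -> D w -> F w -> Q w) ->
  {ae P, forall w, A w} -> {ae P, forall w, B w} -> {ae P, forall w, C w} ->
  {ae P, forall w, D w} -> {ae P, forall w, F w} -> {ae P, forall w, Q w}.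
Proof.
move=> h hA hB hC hD hF; near=> w; apply: h; near: w.
- exact: hA.
- exact: hB.
- exact: hC.
- exact: hD.
- exact: hF.
Unshelve. all: by end_near. Qed.

Let addA : associative L0_add.
Proof.
move=> x y z; apply: L0_repr_inj.
move: (addE x (L0_add y z)) (addE y z) (addE (L0_add x y) z) (addE x y).
by apply: filterS4 => w -> -> -> -> _; rewrite addrA.
Qed.

Let addC : commutative L0_add.
Proof.
move=> x y; apply: L0_repr_inj; move: (addE x y) (addE y x).
by apply: filterS2 => w -> -> _; rewrite addrC.
Qed.

Let add0 : left_id (L0_const (0 : K)) L0_add.
Proof.
move=> x; apply: L0_repr_inj; move: (addE (L0_const (0 : K)) x) (constE (0 : K)).
by apply: filterS2 => w -> -> _; rewrite add0r.
Qed.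

Let addN : left_inverse (L0_const (0 : K)) L0_opp L0_add.
Proof.
move=> x; apply: L0_repr_inj.
move: (addE (L0_opp x) x) (oppE x) (constE (0 : K)).
by apply: filterS3 => w -> -> -> _; rewrite addNr.
Qed.

HB.instance Definition _ := GRing.isZmodule.Build (L0 K) addA addC add0 addN.

Let mulA : associative L0_mul.
Proof.
move=> x y z; apply: L0_repr_inj.
move: (mulE x (L0_mul y z)) (mulE y z) (mulE (L0_mul x y) z) (mulE x y).
by apply: filterS4 => w -> -> -> -> _; rewrite mulrA.
Qed.

Let mulC : commutative L0_mul.
Proof.
move=> x y; apply: L0_repr_inj; move: (mulE x y) (mulE y x).
by apply: filterS2 => w -> -> _; rewrite mulrC.
Qed.

Let mul1 : left_id (L0_const (1 : K)) L0_mul.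
Proof.
move=> x; apply: L0_repr_inj; move: (mulE (L0_const (1 : K)) x) (constE (1 : K)).
by apply: filterS2 => w -> -> _; rewrite mul1r.
Qed.

Let mulDl : left_distributive L0_mul +%R.
Proof.
move=> x y z; apply: L0_repr_inj.
move: (mulE (L0_add x y) z) (addE x y) (addE (L0_mul x z) (L0_mul y z))
  (mulE x z) (mulE y z).
by apply: filterS5 => w -> -> -> -> -> _; rewrite mulrDl.
Qed.

Let one_neq0 : L0_const (1 : K) != 0.
Proof.
apply/eqP => /L0_class_eqP [N [mN N0 sN]].
have NT : N = setT.
  by apply/seteqP; split => // w _; apply: sN => /= /(_ I)/eqP; rewrite oner_eq0.
by move: N0; rewrite NT probability_setT => /eqP; rewrite onee_eq0.
Qed.

HB.instance Definition _ := GRing.Zmodule_isComNzRing.Build (L0 K)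
  mulA mulC mul1 mulDl one_neq0.

Lemma L0_addE xi eta :
  {ae P, forall w, L0_repr (xi + eta) w = L0_repr xi w + L0_repr eta w}.
Proof. exact: addE. Qed.
Lemma L0_oppE xi : {ae P, forall w, L0_repr (- xi) w = - L0_repr xi w}.
Proof. exact: oppE. Qed.
Lemma L0_mulE xi eta :
  {ae P, forall w, L0_repr (xi * eta) w = L0_repr xi w * L0_repr eta w}.
Proof. exact: mulE. Qed.
Lemma L0_constE (c : K) : {ae P, forall w, L0_repr (L0_const c) w = c}.
Proof. exact: constE. Qed.

Lemma measurable_indicator (A : set Omega) (mA : measurable A) :
  measurable_fun setT (fun w => if w \in A then (1 : K) else 0).
Proof.
apply: measurable_fun_ifT => //.
apply: (@measurable_fun_bool _ _ _ _ true) => //.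
rewrite setTI (_ : _ @^-1` _ = A) //.
by apply/seteqP; split=> w /=; [move/set_mem|move/mem_set].
Qed.

Definition indicator (a : measure_algebra P) : L0 K :=
  L0_class (measurable_indicator (measurable_event_repr a)).

End Ring.

(* In R[i], 0 <= z means that z is real and nonnegative, so the next two
   sets are L^0_+(F) and L^0(F, (0,1)) seen inside L^0(F, K). *)
Definition L0_nonneg (k : scalar_kind) : set (L0 (scalars R k)) :=
  L0_in [set z : scalars R k | 0 <= z].

Definition L0_open01 (k : scalar_kind) : set (L0 (scalars R k)) :=
  L0_in [set z : scalars R k | 0 < z < 1].

End L0.

Section Modules.
Context d (Omega : measurableType d) (R : realType) (P : probability Omega R)
  (k : scalar_kind) (E : lmodType (L0 P (scalars R k))).

Local Notation K := (scalars R k).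
Local Notation ma := (measure_algebra P).
Local Notation "'\I_' a" := (indicator k a) (at level 8, a at level 2).
Local Notation "c %:L" := (L0_const P c) (at level 2, format "c %:L").

Definition regular : Prop :=
  forall (a : nat -> ma) (x y : E), partition_of_unity a ->
    (forall k, \I_(a k) *: x = \I_(a k) *: y) -> x = y.

(* z is the countable concatenation of the x_k along the partition a; in a
   regular module it is unique. *)
Definition is_concat (a : nat -> ma) (x : nat -> E) (z : E) : Prop :=
  forall k, \I_(a k) *: z = \I_(a k) *: x k.

(* For H included in a sigma-stable set G, all the elements z below are in G
   when the module is regular. *)
Definition sigma_hull (H : set E) : set E :=
  [set z | exists (a : nat -> ma) (h : nat -> E),
    [/\ partition_of_unity a, forall k, H (h k) & is_concat a h z]].

Definition finite_concat M (a : 'I_M -> ma) (G : 'I_M -> set E) : set E :=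
  [set z | exists x : 'I_M -> E,
    (forall m, G m (x m)) /\ z = \sum_(m < M) \I_(a m) *: x m].

Definition hull (D : set (L0 P K)) (G : set E) : set E :=
  [set z | exists (k : nat) (x : 'I_k -> E) (xi : 'I_k -> L0 P K),
    [/\ forall i, G (x i), forall i, D (xi i), \sum_(i < k) xi i = 1
      & z = \sum_(i < k) xi i *: x i]].

Definition conv_L0 : set E -> set E := hull (@L0_nonneg _ _ _ P k).

(* The usual convex hull: E is a linear space over K through the constant
   classes. *)
Definition conv : set E -> set E := hull [set c%:L | c in [set c : K | 0 <= c]].

Definition L0_affinely_independent n (x : 'I_n.+1 -> E) : Prop :=
  forall xi : 'I_n.+1 -> L0 P K,
    \sum_(i < n.+1 | i != ord0) xi i *: (x i - x ord0) = 0 ->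
    forall i, i != ord0 -> xi i = 0.

Definition affinely_independent n (x : 'I_n.+1 -> E) : Prop :=
  forall c : 'I_n.+1 -> K, (forall i, c i \is Num.real) ->
    \sum_(i < n.+1 | i != ord0) (c i)%:L *: (x i - x ord0) = 0 ->
    forall i, i != ord0 -> c i = 0.

(* Whether F is a face, with respect to the hull operator C, of the simplex with
   vertices x_0, ..., x_n. *)
Definition is_face (C : set E -> set E) n (x : 'I_n.+1 -> E) (F : set E) : Prop :=
  exists I : {set 'I_n.+1}, I != finset.set0 /\ F = C (x @` [set` I]).

(* Simplexes are given by their vertices, so a finite family of n-dimensional
   simplexes is a family G of (n+1)-tuples indexed by a finite type. *)
Definition simplicial_subdivision n (x : 'I_n.+1 -> E)
    (J : finType) (G : J -> 'I_n.+1 -> E) : Prop :=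
  [/\ forall j, affinely_independent (G j),
      conv (range x) = \bigcup_j conv (range (G j))
    & forall i j,
        let F := conv (range (G i)) `&` conv (range (G j)) in
        F = set0 \/ is_face conv (G i) F /\ is_face conv (G j) F].

Definition L0_simplicial_subdivision n (x : 'I_n.+1 -> E)
    (J : finType) (G : J -> 'I_n.+1 -> E) : Prop :=
  [/\ forall j, L0_affinely_independent (G j),
      conv_L0 (range x) = sigma_hull (\bigcup_j conv_L0 (range (G j))),
      forall i j,
        let F := conv_L0 (range (G i)) `&` conv_L0 (range (G j)) in
        F = set0 \/ is_face conv_L0 (G i) F /\ is_face conv_L0 (G j) F
    & simplicial_subdivision x G].

(* The L0-simplex with vertices y_0, ..., y_n is a member of the family G; the
   vertices may be listed in another order. *)
Definition simplex_in n (J : finType) (G : J -> 'I_n.+1 -> E)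
    (y : 'I_n.+1 -> E) : Prop :=
  L0_affinely_independent y /\ exists j, range y = range (G j).

Definition ext_L0 (G : set E) : set E :=
  [set h | G h /\ forall (x y : E) (lambda : L0 P K), G x -> G y ->
    L0_open01 lambda -> lambda *: x + (1 - lambda) *: y = h -> x = h /\ y = h].

Definition ext_subdivision n (J : finType) (G : J -> 'I_n.+1 -> E) : set E :=
  sigma_hull (\bigcup_j ext_L0 (conv_L0 (range (G j)))).

(* Labels are numbered from 0 to n, and only the values of phi on
   ext_subdivision G are relevant. The equality of phi z with the concatenation
   of the phi (y k) along a is expressed by (phi z = phi (y k)) >= a k. *)
Definition L0_labeling n (J : finType) (G : J -> 'I_n.+1 -> E)
    (phi : E -> L0 P 'I_n.+1) : Prop :=
  forall (a : nat -> ma) (y : nat -> E) (z : E), partition_of_unity a ->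
    (forall k, ext_subdivision G (y k)) -> ext_subdivision G z ->
    is_concat a y z ->
    forall k, (a k <= L0_eq_event (phi z) (phi (y k)))%O.

Definition proper_L0_labeling n (x : 'I_n.+1 -> E)
    (J : finType) (G : J -> 'I_n.+1 -> E) (phi : E -> L0 P 'I_n.+1) : Prop :=
  L0_labeling G phi /\
  forall (y : E) (lambda : 'I_n.+1 -> L0 P K), ext_subdivision G y ->
    (forall i, L0_nonneg (lambda i)) -> \sum_i lambda i = 1 ->
    y = \sum_i lambda i *: x i ->
    forall i, (L0_eq_event (phi y) (L0_const P i) `&`
               L0_eq_event (lambda i) 0 = \bot)%O.

Definition completely_labeled n (x : 'I_n.+1 -> E)
    (J : finType) (G : J -> 'I_n.+1 -> E) (phi : E -> L0 P 'I_n.+1)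
    (y : 'I_n.+1 -> E) : Prop :=
  [/\ proper_L0_labeling x G phi, forall j, ext_subdivision G (y j)
    & range (fun j => phi (y j)) = range (@L0_const _ _ _ P _ 'I_n.+1)].

End Modules.

(* Main.v *)
Require Import Defs.
From HB Require Import structures.
From mathcomp Require Import all_boot all_order all_algebra.
From mathcomp Require Import fingroup perm ring complex.
From mathcomp Require Import all_classical all_reals all_analysis.
Import Order.Theory GRing.Theory Num.Theory.
Set Implicit Arguments.
Unset Strict Implicit.
Unset Printing Implicit Defensive.
Local Open Scope classical_set_scope.
Local Open Scope ring_scope.

(* The vertices of the subdivision have constant barycentric coordinates, and for
   almost every w the labels phi(v)(w) form a proper labeling in the sense of
   Sperner.  Sperner's lemma therefore provides, for almost every w, a cell G j
   and an ordering s of its vertices whose labels at w are 0, ..., n; there are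
   finitely many pairs (j, s), so the events on which each of them works can be
   made into a partition of unity, and the vertices are glued along it.

   Sperner's lemma itself is proved by a degree argument.  If the vertices v of a
   triangulation of the simplex, given as matrices A j of barycentric coordinates,
   are moved to points w(v) of the affine span of the face carrying v, then
   sum_j sg(det A_j) det(w(A_j)) does not change.  It is positive when w is the
   identity, and a nonzero term for w(v) = e_(phi(v)) is a completely labeled
   cell. *)

(** * Determinants as functions of one row *)

Section Determinants.
Context (F : comNzRingType) (m : nat).
Implicit Types (A B : 'M[F]_m) (q : 'rV[F]_m).

(** The cofactors along row [i] do not involve row [i], so those of [A] also expand [\det B]. *)
Lemma det_replace_row A B i : (forall k, k != i -> row k B = row k A) ->
  \det B = (row i B *m \adj A) 0 i.
Proof.
move=> eBA; rewrite (expand_det_row _ i) mxE; apply: eq_bigr => k _.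
rewrite !mxE; congr (_ * _); rewrite /cofactor; congr (_ * \det _).
apply/matrixP => a b; rewrite !mxE.
have /eBA/rowP/(_ (lift k b)) : lift i a != i by rewrite eq_sym neq_lift.
by rewrite !mxE.
Qed.

Definition set_row A i q : 'M[F]_m :=
  \matrix_(k, c) if k == i then q 0 c else A k c.

Lemma row_set_row A i q k : row k (set_row A i q) = if k == i then q else row k A.
Proof. by apply/rowP => c; rewrite !mxE; case: eqP => // _; rewrite mxE. Qed.

Lemma det_set_row A i q : \det (set_row A i q) = (q *m \adj A) 0 i.
Proof.
rewrite (@det_replace_row A _ i); first by rewrite row_set_row eqxx.
by move=> k /negbTE ki; rewrite row_set_row ki.
Qed.

(** Both sides are the product of [q], [\adj A], [A] and [l], bracketed in two ways. *)
Lemma sum_det_set_row A q (l : 'cV[F]_m) :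
  \sum_i (A *m l) i 0 * \det (set_row A i q) = \det A * (q *m l) 0 0.
Proof.
have -> : \det A * (q *m l) 0 0 = (q *m \adj A *m (A *m l)) 0 0.
  by rewrite -mulmxA (mulmxA (\adj A)) mul_adj_mx mul_scalar_mx -scalemxAr [RHS]mxE.
by rewrite [RHS]mxE; apply: eq_bigr => i _; rewrite det_set_row mulrC.
Qed.

Lemma det_row_perm (s : 'S_m) A : \det (row_perm s A) = (-1) ^+ s * \det A.
Proof. by rewrite row_permE det_mulmx det_perm. Qed.

End Determinants.

(** By counting, the image under [f] of the points other than [k0] misses some point, and [k0] can
    be sent there. *)
Lemma extend_perm (T : finType) (k0 : T) (f : T -> T) :
  {in [pred k | k != k0] &, injective f} ->
  exists s : {perm T}, forall k, k != k0 -> s k = f k.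
Proof.
move=> fI; pose Q := [pred k | k != k0].
have [l0 l0Q] : exists l, l \notin [seq f k | k in Q].
  apply/existsP; apply: contraT; rewrite negb_exists => /forallP all.
  have /subset_leq_card : T \subset [seq f k | k in Q].
    by apply/fintype.subsetP => l _; have := all l; rewrite negbK.
  rewrite card_in_image // cardC1 leqNgt ltn_predL => /negP[].
  by apply/card_gt0P; exists k0.
pose g k := if k == k0 then l0 else f k.
have nf k : k != k0 -> l0 != f k.
  by move=> kk0; apply: contraNneq l0Q => ->; apply: fintype.image_f; rewrite inE.
have gI : injective g.
  move=> k l; rewrite /g.
  case: (eqVneq k k0) => [->|kk0]; case: (eqVneq l k0) => [->|ll0] //.
  - by move=> /eqP; rewrite (negbTE (nf _ _)).
  - by move=> /eqP; rewrite eq_sym (negbTE (nf _ _)).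
  - exact: fI.
by exists (perm gI) => k /negbTE kk0; rewrite permE /g kk0.
Qed.

Lemma ler_sum_norm (F : numDomainType) (I : finType) (f : I -> F) i :
  `|f i| <= \sum_k `|f k|.
Proof. by rewrite (bigD1 i) //= lerDl sumr_ge0. Qed.

(** * Sperner's lemma for subdivisions given by matrices of barycentric coordinates *)

Section Sperner.
Context (F : realFieldType) (n : nat).
Local Notation pt := 'rV[F]_n.+1.

(* The rows of A j are the vertices of the cell j.  Both conditions are stated for
   the cones spanned by the cells, so that no weights need to be normalized. *)
Definition subdivision_cover (J : finType) (A : J -> 'M[F]_n.+1) : Prop :=
  forall p : pt, (forall m, 0 < p 0 m) ->
    exists j (c : pt), (forall k, 0 <= c 0 k) /\ p = c *m A j.

Definition subdivision_faces (J : finType) (A : J -> 'M[F]_n.+1) : Prop :=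
  forall i j (c c' : pt), (forall k, 0 <= c 0 k) -> (forall k, 0 <= c' 0 k) ->
    c *m A i = c' *m A j ->
    forall k, 0 < c 0 k -> exists l, row l (A j) = row k (A i).

(** * The degree argument, when no cell is listed twice up to the order of its vertices *)

Section Distinct.
Context (J : finType) (A : J -> 'M[F]_n.+1).
Context (Adet : forall j, \det (A j) != 0).
Context (Arow : forall j i, \sum_m A j i m = 1).
Context (Age0 : forall j i m, 0 <= A j i m).
Context (Acover : subdivision_cover A).
Context (Aface : subdivision_faces A).
Context (Ainj : forall i j, (exists s, row_perm s (A j) = A i) -> i = j).

Let unitA j : A j \in unitmx. Proof. by rewrite unitmxE unitfE. Qed.

Let row_inj j : injective (fun k => row k (A j)).
Proof.
move=> k l /= e; apply/eqP/negP => /negP kl.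
have := Adet j; rewrite (determinant_alternate kl) ?eqxx // => m.
by have /rowP/(_ m) := e; rewrite !mxE.
Qed.

(* Otherwise the vertices of A i and of A j off the common facet lie on the same
   side of it, and a point near the facet is interior to both cells. *)
Lemma opposite_sides i j k0 (s : 'S_n.+1) : i != j ->
  (forall k, k != k0 -> row (s k) (A j) = row k (A i)) ->
  (-1) ^+ s * \det (A j) * \det (A i) < 0.
Proof.
move=> ij es; rewrite lt_neqAle !mulf_eq0 signr_eq0 !(negbTE (Adet _)) /=.
rewrite leNgt; apply/negP => side; case/negP: ij; apply/eqP/Ainj.
pose B := row_perm s (A j).
have rB k : row k B = row (s k) (A j) by apply/rowP => m; rewrite !mxE.
have eB k : k != k0 -> row k B = row k (A i) by move=> ?; rewrite rB es.
(* These are the coordinates in [A i] of the vertex of [A j] off the facet. By Cramer's rule the one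
   at [k0] is [\det B / \det (A i)], which [side] makes positive. *)
pose al : pt := row k0 B *m invmx (A i).
have al_gt0 : 0 < al 0 k0.
  rewrite /al /invmx unitA -scalemxAr mxE -(det_replace_row eB).
  rewrite det_row_perm.
  move: side (Adet i); move: (_ * \det (A j)) (\det (A i)) => y x yx x0.
  have : 0 < x^-1 * x^-1 by rewrite -expr2 exprn_even_gt0 //= invr_eq0.
  by rewrite -(pmulr_rgt0 _ yx) mulrACA divff // mulr1 mulrC.
have alA : al *m A i = row k0 B by rewrite mulmxKV.
(* The vector [e] has weight 1 on each vertex of the facet. Since [t] outgrows every coordinate of
   [al], one point gets the positive coordinates [c] in [A i] and the nonnegative ones [c'] in
   [B]. *)
clearbody al; pose t := 1 + \sum_k `|al 0 k|.
pose e : pt := const_mx 1 - delta_mx 0 k0.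
have eM (M : 'M[F]_n.+1) : e *m M = \sum_(k | k != k0) row k M.
  rewrite mulmx_sum_row (bigD1 k0) //= !mxE !eqxx subrr scale0r add0r.
  by apply: eq_bigr => k /negbTE kk0; rewrite !mxE eqxx kk0 subr0 scale1r.
have t_gt k : 0 < t + al 0 k.
  rewrite /t -addrA ltr_pwDl // -lerBlDr sub0r.
  apply: le_trans (ler_norm _) _; rewrite normrN.
  exact: (ler_sum_norm (al 0)).
have t_ge0 : 0 <= t by rewrite addr_ge0 // sumr_ge0.
pose c := al + t *: e.
have c_gt0 k : 0 < c 0 k.
  rewrite !mxE eqxx /=; case: (eqVneq k k0) => [->|_] /=.
    by rewrite subrr mulr0 addr0.
  by rewrite subr0 mulr1 addrC.
pose c' := delta_mx 0 k0 + t *: e.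
have c'_ge0 k : 0 <= c' 0 k.
  rewrite !mxE eqxx /=; case: (eqVneq k k0) => [_|_] /=.
    by rewrite subrr mulr0 addr0.
  by rewrite subr0 mulr1 add0r.
have cc' : c *m A i = (c' *m perm_mx s) *m A j.
  rewrite -mulmxA -row_permE -/B !mulmxDl -!scalemxAl !eM alA.
  rewrite -rowE; congr (_ + _ *: _); apply: eq_bigr => k kk0.
  by rewrite eB.
have c's_ge0 k : 0 <= (c' *m perm_mx s) 0 k.
  by rewrite -(invgK s) -col_permE mxE.
(* As [c] is positive at [k0], the vertex [k0] of [A i] is also a vertex of [A j]; the only one not
   matched with another vertex of [A i] has index [s k0]. *)
have [l el] := Aface (fun k => ltW (c_gt0 k)) c's_ge0 cc' (c_gt0 k0).
have ls : l = s k0.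
  rewrite -[l](permKV s); congr (s _); apply/eqP/negP => /negP ne.
  have := es _ ne; rewrite permKV el => /row_inj e0.
  by rewrite -e0 eqxx in ne.
exists s; apply/row_matrixP => k; rewrite -/B.
case: (eqVneq k k0) => [->|]; last exact: eB.
by rewrite rB -ls el.
Qed.

(** A pair stands for the facet of the cell [p.1] opposite to its vertex [p.2]; adjacent pairs
    describe one facet seen from two cells. *)
Definition adjacent (p q : J * 'I_n.+1) : bool :=
  (p.1 != q.1) && [exists s : 'S_n.+1, (s p.2 == q.2) &&
    [forall k, (k != p.2) ==> (row (s k) (A q.1) == row k (A p.1))]].

Lemma adjacentP p q : reflect (p.1 != q.1 /\ exists2 s : 'S_n.+1, s p.2 = q.2 &
    forall k, k != p.2 -> row (s k) (A q.1) = row k (A p.1))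
  (adjacent p q).
Proof.
apply: (iffP andP) => -[ne].
  case/existsP=> s /andP[/eqP sk /forallP h]; split=> //; exists s => // k kk.
  by have /implyP/(_ kk)/eqP := h k.
case=> s sk h; split=> //; apply/existsP; exists s; rewrite sk eqxx /=.
by apply/forallP => k; apply/implyP => kk; rewrite h.
Qed.

Lemma adjacent_sym p q : adjacent p q = adjacent q p.
Proof.
suff h p' q' : adjacent p' q' -> adjacent q' p' by apply/idP/idP; exact: h.
case/adjacentP=> ne [s sk h]; apply/adjacentP; rewrite eq_sym; split=> //.
exists (s^-1)%g; first by rewrite -sk permK.
move=> k kq; rewrite -h ?permKV //; apply: contraNneq kq => e.
by rewrite -sk -e permKV.
Qed.

(** A facet has only two sides: three distinct cells along it would be pairwise opposite, yet the
    product of the three quantities in [opposite_sides] would be positive. *)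
Lemma adjacent_uniq p q r : adjacent p q -> adjacent p r -> q = r.
Proof.
case/adjacentP=> pq [s sq hs] /adjacentP[pr [u ur hu]].
have oq := opposite_sides pq hs; have or := opposite_sides pr hu.
have hus k : k != q.2 -> row ((s^-1 * u)%g k) (A r.1) = row k (A q.1).
  move=> kq; have ne : (s^-1)%g k != p.2.
    by apply: contraNneq kq => e; rewrite -sq -e permKV.
  by rewrite permM hu // -hs // permKV.
have e1 : q.1 = r.1.
  apply/eqP/negP => /negP qr; have := opposite_sides qr hus.
  rewrite odd_permM odd_permV signr_addb ltNge => /negP[].
  have d0 : 0 < \det (A p.1) ^+ 2 by rewrite exprn_even_gt0 //=.
  rewrite -(pmulr_lge0 _ d0).
  move: oq or; set a := (-1) ^+ s; set b := (-1) ^+ u => oq or.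
  have : 0 < (a * \det (A q.1) * \det (A p.1)) * (b * \det (A r.1) * \det (A p.1)).
    by rewrite nmulr_lgt0.
  by move=> /ltW; congr (0 <= _); ring.
rewrite [q]surjective_pairing [r]surjective_pairing -e1; congr (_, _).
have eu k : k != p.2 -> u k = s k.
  by move=> kp; apply: (@row_inj q.1); rewrite /= hs // -hu // e1.
rewrite -sq -ur; apply/esym; rewrite -[s p.2](permKV u).
case: (eqVneq ((u^-1)%g (s p.2)) p.2) => [-> //|ne].
by have := eu _ ne; rewrite permKV => /perm_inj e0; rewrite -e0 eqxx in ne.
Qed.

(* A point close to the barycentre of the facet opposite to the vertex k0 of
   A i, but on the other side of it, lies in the neighbouring cell. *)
Lemma adjacent_ex i k0 :
  (forall m, exists2 k, k != k0 & A i k m != 0) ->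
  exists q, adjacent (i, k0) q.
Proof.
move=> inner; pose a := row k0 (A i).
pose e : pt := const_mx 1 - delta_mx 0 k0.
pose b : pt := e *m A i.
have e_ge0 k : 0 <= e 0 k.
  by rewrite !mxE eqxx; case: eqP; rewrite /= ?subrr // subr0.
have b_gt0 m : 0 < b 0 m.
  have [k kk0 km] := inner m.
  rewrite mxE (bigD1 k) //= ltr_pwDl //.
    by rewrite !mxE eqxx (negbTE kk0) subr0 mul1r lt0r km Age0.
  by apply: sumr_ge0 => l _; rewrite mulr_ge0.
pose al j := a *m invmx (A j); pose be j := b *m invmx (A j).
(* The last sum makes [t *: b - a] positive. The double sum ranges over all cells because the one
   containing that point is only found later; it forbids negative coordinates of [b] there. *)
pose t := 1 + \sum_j \sum_k `|al j 0 k / be j 0 k| + \sum_m `|a 0 m / b 0 m|.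
have t1 m : `|a 0 m / b 0 m| < t.
  apply: le_lt_trans (ler_sum_norm (fun m => a 0 m / b 0 m) m) _.
  by rewrite ltrDr ltr_pwDl // sumr_ge0 // => ? _; exact: sumr_ge0.
have t2 j k : `|al j 0 k / be j 0 k| < t.
  apply: le_lt_trans (ler_sum_norm (fun k => al j 0 k / be j 0 k) k) _.
  rewrite /t (bigD1 j) //= addrCA -addrA ltr_pwDr // -?addrA ?ltr_pwDl //.
  by rewrite addr_ge0 ?sumr_ge0 // => ? _; exact: sumr_ge0.
have p_gt0 m : 0 < (t *: b - a) 0 m.
  rewrite 2!mxE [X in _ + X]mxE subr_gt0 -ltr_pdivrMr //.
  exact: le_lt_trans (ler_norm _) (t1 m).
have [j [c [c_ge0 ec]]] := Acover p_gt0.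
have cE : c = t *: be j - al j.
  by rewrite /be /al scalemxAl -mulmxBl ec mulmxK.
have be_ge0 k : 0 <= be j 0 k.
  rewrite leNgt; apply/negP => be_lt0.
  have := c_ge0 k; rewrite cE 2!mxE [X in _ + X]mxE subr_ge0.
  rewrite -ler_ndivlMr // leNgt.
  by rewrite (le_lt_trans (ler_norm _) (t2 j k)).
(* The point [b] lies in the cones of both cells and has weight 1 in [A i] on every vertex of the
   facet. *)
have shared k : k != k0 -> exists l, row l (A j) == row k (A i).
  move=> kk0; have [||l el] := @Aface i j e (be j) e_ge0 be_ge0 _ k.
  - by rewrite /be mulmxKV.
  - by rewrite !mxE eqxx (negbTE kk0) subr0.
  - by exists l; apply/eqP.
pose f k := if [pick l | row l (A j) == row k (A i)] is Some l then l else k.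
have fE k : k != k0 -> row (f k) (A j) = row k (A i).
  move=> /shared[l el]; rewrite /f; case: pickP => [l' /eqP //|/(_ l)].
  by rewrite el.
have [s sE] : exists s : 'S_n.+1, forall k, k != k0 -> s k = f k.
  apply: extend_perm => k l; rewrite !inE => kk0 lk0 ekl.
  by apply: (@row_inj i); rewrite /= -!fE // ekl.
exists (j, s k0); apply/adjacentP; split=> /=; last first.
  by exists s => // k kk0; rewrite sE // fE.
(* In the cell [i] itself the point would have coordinate -1 at [k0]. *)
apply/negP => /eqP ij; have := c_ge0 k0; rewrite cE -ij.
rewrite /be /al /b mulmxK // /a rowE mulmxK // !mxE !eqxx subrr mulr0 sub0r.
by rewrite oppr_ge0 ler10.
Qed.

Definition image_cell (w : pt -> pt) j : 'M[F]_n.+1 :=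
  \matrix_(k, m) w (row k (A j)) 0 m.

(** When the images have coordinates of sum 1, this is, up to a constant factor, the total volume of
    the image cells, signed by whether [w] keeps or reverses their orientation. *)
Definition degree (w : pt -> pt) : F :=
  \sum_j Num.sg (\det (A j)) * \det (image_cell w j).

Definition carried (w : pt -> pt) : Prop := forall j k,
  \sum_m w (row k (A j)) 0 m = 1 /\
  forall m, A j k m = 0 -> w (row k (A j)) 0 m = 0.

Lemma row_image_cell w j k : row k (image_cell w j) = w (row k (A j)).
Proof. by apply/rowP => m; rewrite !mxE. Qed.

(* If u is the displacement of v, expand det(u, w_1, ..., w_n) as the sum of the
   det(u, w_1, ..., w v, ..., w_n): the terms now belong to the facets through v,
   those of two adjacent cells cancel and those on the boundary vanish. *)
Lemma degree_displacement (w w0 : pt -> pt) v : carried w ->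
  (forall x, x != v -> w0 x = w x) ->
  \sum_m w0 v 0 m = 0 ->
  (forall m, v 0 m = 0 -> w0 v 0 m = 0) ->
  \sum_(j | [exists k, row k (A j) == v])
     Num.sg (\det (A j)) * \det (image_cell w0 j) = 0.
Proof.
move=> cw ew0 su cu.
(* [thru p] tells that [v] lies on the facet [p], and [N p] joins the image of that facet under [w0]
   to the point [w v]: up to the order of the rows it depends on the facet alone. *)
pose thru (p : J * 'I_n.+1) := [exists k, (k != p.2) && (row k (A p.1) == v)].
pose N (p : J * 'I_n.+1) := set_row (image_cell w0 p.1) p.2 (w v).
pose T p := if thru p then Num.sg (\det (A p.1)) * \det (N p) else 0.
have -> : \sum_(j | [exists k, row k (A j) == v])
     Num.sg (\det (A j)) * \det (image_cell w0 j) = \sum_p T p.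
  rewrite -(pair_bigA _ (fun j k => T (j, k))) /= big_mkcond.
  apply: eq_bigr => j _; case: existsP => [[k0 /eqP ek0]|nex]; last first.
    rewrite big1 // => k _; rewrite /T /thru /=; case: existsP => //.
    by case=> l /andP[_ el]; case: nex; exists l.
  have thruE k : thru (j, k) = (k != k0).
    apply/existsP/idP => [[l /andP[/= lk /eqP el]]|kk0].
      rewrite (_ : k0 = l); first by rewrite eq_sym.
      by apply: (@row_inj j); rewrite /= el.
    by exists k0; rewrite /= eq_sym kk0 ek0 eqxx.
  (* The all-one column turns the weights of [sum_det_set_row] into row sums: 0 for the row of [v],
     where [w0] is a displacement, and 1 for the other rows and for [w v]. *)
  pose l : 'cV[F]_n.+1 := const_mx 1.
  have sl (M : 'M[F]_n.+1) k : (M *m l) k 0 = \sum_m M k m.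
    by rewrite mxE; apply: eq_bigr => m _; rewrite mxE mulr1.
  have wv : (w v *m l) 0 0 = 1.
    rewrite mxE -[RHS](proj1 (cw j k0)) ek0.
    by apply: eq_bigr => m _; rewrite mxE mulr1.
  have := sum_det_set_row (image_cell w0 j) (w v) l; rewrite wv mulr1 => <-.
  rewrite mulr_sumr; apply: eq_bigr => k _; rewrite /T thruE sl.
  case: (eqVneq k k0) => [->|kk0] /=.
    under eq_bigr do rewrite mxE.
    by rewrite ek0 su mul0r mulr0.
  under eq_bigr do rewrite mxE.
  rewrite ew0; first by rewrite (proj1 (cw j k)) mul1r.
  by apply: contra kk0; rewrite -ek0 => /eqP/row_inj ->.
have thru_adj p q : adjacent p q -> thru p -> thru q.
  case/adjacentP=> _ [s sq h] /existsP[k /andP[kp /eqP ev]].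
  apply/existsP; exists (s k); rewrite h // ev eqxx andbT -sq.
  by rewrite (inj_eq perm_inj).
have T_adj p q : adjacent p q -> T q = - T p.
  move=> apq; have tpq : thru p = thru q.
    by apply/idP/idP; apply: thru_adj; rewrite // adjacent_sym.
  rewrite /T tpq; case: ifP => _; last by rewrite oppr0.
  case/adjacentP: apq => ne [s sq h].
  (* The rows of [N p] and [N q] differ by [s], while by [opposite_sides] the orientations of the
     two cells differ by the opposite of its sign. *)
  have -> : \det (N p) = (-1) ^+ s * \det (N q).
    rewrite -det_row_perm; congr (\det _); apply/row_matrixP => k.
    rewrite row_set_row; have -> : row k (row_perm s (N q)) = row (s k) (N q).
      by apply/rowP => m; rewrite !mxE.
    rewrite row_set_row -sq (inj_eq perm_inj); case: eqVneq => // kp.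
    by rewrite !row_image_cell h.
  have := opposite_sides ne h => side.
  have : Num.sg ((-1) ^+ s * \det (A q.1) * \det (A p.1)) = -1 by apply: ltr0_sg.
  rewrite !sgrM sgrX sgrN1 => e1.
  have: Num.sg (\det (A p.1)) * Num.sg (\det (A p.1)) = 1.
    by rewrite -expr2 sqr_sg Adet.
  move: e1; set a := (-1) ^+ s; set x := Num.sg _; set y := Num.sg _ => e1 e2.
  have e3 : x = - (a * y).
    have ea : a * a = 1 by rewrite -expr2 sqrr_sign.
    by rewrite -[x]mul1r -ea -[LHS]mulr1 -e2; rewrite -mulN1r -e1; ring.
  by rewrite e3; ring.
have T_bdry p : ~ (exists q, adjacent p q) -> T p = 0.
  move=> nadj; rewrite /T; case: ifP => // /existsP[k /andP[kp /eqP ev]].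
  (* By [adjacent_ex], a facet without neighbour lies in a hyperplane where some coordinate [m]
     vanishes; column [m] of [N p] is then zero. *)
  have /existsP[m /forallP bd] :
      [exists m, [forall k, (k != p.2) ==> (A p.1 k m == 0)]].
    apply: contra_notT nadj; rewrite negb_exists => /forallP inn.
    rewrite [p]surjective_pairing; apply: adjacent_ex => m.
    have := inn m; rewrite negb_forall => /existsP[l].
    by rewrite negb_imply => /andP[lp lm]; exists l.
  have bd0 l : l != p.2 -> A p.1 l m = 0.
    by move=> lp; have /implyP/(_ lp)/eqP := bd l.
  have vm : v 0 m = 0 by rewrite -ev mxE bd0.
  rewrite (expand_det_col (N p) m) big1 ?mulr0 // => l _.
  rewrite !mxE; case: eqP => [_|/eqP lp].
    by rewrite -ev (proj2 (cw _ _)) ?mul0r ?bd0.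
  case: (eqVneq (row l (A p.1)) v) => [->|ne].
    by rewrite cu ?mul0r.
  by rewrite ew0 // (proj2 (cw _ _)) ?mul0r ?bd0.
have T1 p : \sum_(q | adjacent p q) T p = T p.
  have [/existsP[q apq]|nex] := boolP [exists q, adjacent p q].
    rewrite (big_pred1 q) // => r; apply/idP/eqP => [apr|-> //].
    exact: adjacent_uniq apr apq.
  rewrite [RHS]T_bdry ?big1 // => [q apq|[q apq]].
    by case/existsP: nex; exists q.
  by case/existsP: nex; exists q.
(* Replacing each term by that of the adjacent facet and exchanging the sums shows that the total is
   its own opposite. *)
have : \sum_p T p = - \sum_p T p.
  rewrite -[in LHS](eq_bigr _ (fun p _ => T1 p)) (exchange_big_dep xpredT) //= -sumrN.
  apply: eq_bigr => q _; rewrite -[in RHS]T1 -sumrN.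
  under eq_bigl do rewrite adjacent_sym.
  by apply: eq_bigr => p; rewrite adjacent_sym => /T_adj ->; rewrite opprK.
by move/eqP; rewrite -subr_eq0 opprK -mulr2n mulrn_eq0 => /eqP.
Qed.

(** The determinant is linear in the row of [v], so the degrees differ by the sum of
    [degree_displacement] for the displacement [w' v - w v], whose coordinates sum to 0. *)
Lemma degree_move (w w' : pt -> pt) v : carried w -> carried w' ->
  (forall x, x != v -> w' x = w x) -> degree w' = degree w.
Proof.
move=> cw cw' eww'.
pose w0 x := if x == v then w' v - w v else w x.
have w0v : w0 v = w' v - w v by rewrite /w0 eqxx.
have w0n x : x != v -> w0 x = w x by rewrite /w0 => /negbTE ->.
apply/eqP; rewrite -subr_eq0 /degree -sumrB; apply/eqP.
have [/existsP[[j0 k0] /= /eqP ev]|nov] :=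
    boolP [exists p : J * 'I_n.+1, row p.2 (A p.1) == v]; last first.
  rewrite big1 // => j _; rewrite -mulrBr.
  suff -> : image_cell w' j = image_cell w j by rewrite subrr mulr0.
  apply/row_matrixP => k; rewrite !row_image_cell eww' //.
  by apply: contraNneq nov => e; apply/existsP; exists (j, k); apply/eqP.
rewrite -[RHS](@degree_displacement w w0 v) //.
- rewrite [RHS]big_mkcond; apply: eq_bigr => j _; rewrite -mulrBr.
  case: existsP => [[k /eqP ek]|nex].
    congr (_ * _).
    have [M E'] : exists M, forall x, (forall y, y != v -> x y = w y) ->
        image_cell x j = set_row M k (x v).
      exists (image_cell w j) => x xw; apply/row_matrixP => l.
      rewrite row_set_row row_image_cell.
      case: eqVneq => [->|lk]; first by rewrite ek.
      rewrite row_image_cell xw //; apply: contra lk => /eqP.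
      by rewrite -ek => /row_inj ->.
    rewrite (E' w') // (E' w) // (E' w0) //; rewrite !det_set_row w0v.
    by rewrite mulmxBl [RHS]mxE [X in _ = _ + X]mxE.
  suff -> : image_cell w' j = image_cell w j by rewrite subrr mulr0.
  apply/row_matrixP => k; rewrite !row_image_cell eww' //.
  by apply/negP => e; apply: nex; exists k.
- have [s' _] := cw' j0 k0; have [s _] := cw j0 k0.
  rewrite w0v; under eq_bigr do rewrite !mxE.
  by rewrite sumrB -ev s s' subrr.
- move=> m vm; rewrite w0v !mxE.
  have Am : A j0 k0 m = 0 by move: vm; rewrite -ev mxE.
  by rewrite -ev (proj2 (cw' _ _)) // (proj2 (cw _ _)) // subrr.
Qed.

Lemma sperner_distinct (phi : pt -> 'I_n.+1) :
  (forall j k, A j k (phi (row k (A j))) != 0) ->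
  exists j (s : 'S_n.+1), forall m, phi (row (s m) (A j)) = m.
Proof.
move=> phiP.
(* The vertices in the list [s] go to the corner named by their label and the others stay, so each
   new entry moves at most one vertex and [degree_move] applies by induction. *)
pose W (s : seq pt) x : pt := if x \in s then delta_mx 0 (phi x) else x.
have cW s : carried (W s).
  move=> j k; rewrite /W; case: ifP => _; split.
  - rewrite (bigD1 (phi (row k (A j)))) //= mxE !eqxx big1 ?addr0 // => m.
    by rewrite mxE => /negbTE ->.
  - move=> m Am; rewrite mxE eqxx /=; case: eqP => //= e.
    by have := phiP j k; rewrite -e Am eqxx.
  - by under eq_bigr do rewrite mxE; exact: Arow.
  - by move=> m; rewrite mxE.
have dW s : degree (W s) = degree id.
  elim: s => [|v s <-] //; apply: (@degree_move _ _ v) => // x xv.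
  by rewrite /W inE (negbTE xv).
have d_gt0 : 0 < degree id.
  have [|j _] := @Acover (const_mx 1); first by move=> m; rewrite mxE.
  rewrite /degree.
  have E i : image_cell id i = A i by apply/matrixP => k m; rewrite !mxE.
  rewrite (bigD1 j) //= ltr_pwDl //.
    by rewrite E -normrEsg normr_gt0.
  by apply: sumr_ge0 => i _; rewrite E -normrEsg.
pose vs := [seq row p.2 (A p.1) | p : J * 'I_n.+1].
have := d_gt0; rewrite -(dW vs) => /gt_eqF/negbT dn0.
have [j dj] : exists j, \det (image_cell (W vs) j) != 0.
  apply/existsP; apply: contraNT dn0; rewrite negb_exists => /forallP h.
  rewrite /degree big1 // => j _; have := h j; rewrite negbK => /eqP ->.
  by rewrite mulr0.
have rowW k : row k (image_cell (W vs) j) = delta_mx 0 (phi (row k (A j))).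
  rewrite row_image_cell /W; case: ifP => // /negP[].
  by apply/fintype.imageP; exists (j, k).
have pI : injective (fun k => phi (row k (A j))).
  move=> k l /= e; apply/eqP/negP => /negP kl.
  rewrite (determinant_alternate kl) ?eqxx // in dj => m.
  have : row k (image_cell (W vs) j) = row l (image_cell (W vs) j).
    by rewrite !rowW e.
  by move=> /rowP/(_ m); rewrite ![row _ _ _ _]mxE.
exists j, (perm pI)^-1%g => m.
by rewrite -[RHS](permKV (perm pI)) permE.
Qed.

End Distinct.

(** Keeping one representative of each class of cells equal up to the order of vertices preserves
    the covering and face conditions, and leads back to distinct cells. *)
Lemma sperner (J : finType) (A : J -> 'M[F]_n.+1) (phi : pt -> 'I_n.+1) :
  (forall j, \det (A j) != 0) -> (forall j i, \sum_m A j i m = 1) ->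
  (forall j i m, 0 <= A j i m) -> subdivision_cover A -> subdivision_faces A ->
  (forall j k, A j k (phi (row k (A j))) != 0) ->
  exists j (s : 'S_n.+1), forall m, phi (row (s m) (A j)) = m.
Proof.
move=> Adet Arow Age0 Acover Aface phiP.
pose same i j := [exists s : 'S_n.+1, row_perm s (A i) == A j].
have same_refl i : same i i by apply/existsP; exists 1%g; rewrite row_perm1.
have same_sym i j : same i j -> same j i.
  case/existsP=> s /eqP e; apply/existsP; exists (s^-1)%g.
  by rewrite -e -row_permM mulVg row_perm1.
have same_trans i j k : same i j -> same j k -> same i k.
  case/existsP=> s /eqP e /existsP[u /eqP e'].
  by apply/existsP; exists (u * s)%g; rewrite row_permM e e'.
pose rep j := odflt j [pick i | same i j].
have same_rep j : same (rep j) j.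
  by rewrite /rep; case: pickP => [i //|/(_ j)]; rewrite same_refl.
have rep_eq i j : same i j -> rep i = rep j.
  move=> sij; have /eq_pick e : (same^~ i) =1 (same^~ j).
    move=> l; apply/idP/idP => h; first exact: same_trans sij.
    exact/(same_trans _ _ _ h)/same_sym.
  rewrite /rep e; case: pickP => // /(_ j); by rewrite same_refl.
pose J' : finType := {j | rep j == j}.
have [|||||||j [s h]] := @sperner_distinct J' (fun j => A (val j)) _ _ _ _ _ _ phi.
- by [].
- by [].
- by [].
- move=> p p_gt0; have [j [c [c_ge0 ->]]] := Acover _ p_gt0.
  have rr : rep (rep j) == rep j by apply/eqP/rep_eq.
  have /existsP[s /eqP es] := same_rep j.
  exists (exist _ (rep j) rr), (c *m perm_mx s); split=> [k|].
    by rewrite -(invgK s) -col_permE mxE.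
  by rewrite /= -mulmxA -row_permE es.
- by move=> i j; exact: Aface.
- move=> i j [s e]; apply/val_inj; rewrite /= -(eqP (valP i)) -(eqP (valP j)).
  by apply/esym/rep_eq/existsP; exists s; rewrite e.
- by [].
- by exists (val j), s.
Qed.

End Sperner.

(** * The measure algebra read almost everywhere on representatives *)

Section MeasureAlgebraTheory.
Context d (Omega : measurableType d) (R : realType) (P : probability Omega R).
Implicit Types a b : measure_algebra P.

Lemma aeI (A B : Omega -> Prop) : {ae P, forall w, A w} ->
  {ae P, forall w, B w} -> {ae P, forall w, A w /\ B w}.
Proof. exact: filterI. Qed.

Lemma event_classE (A : set Omega) (mA : measurable A) :
  {ae P, forall w, event_repr (event_class P mA) w <-> A w}.
Proof. by apply: filterS (event_reprE P mA) => w /(_ I) ->. Qed.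

Lemma ma_meet_aeE a b :
  {ae P, forall w, event_repr (a `&` b)%O w <-> event_repr a w /\ event_repr b w}.
Proof. exact: event_classE. Qed.

Lemma ma_leP a b :
  (a <= b)%O <-> {ae P, forall w, event_repr a w -> event_repr b w}.
Proof.
rewrite leEmeet; split=> [/eqP <-|ab].
  move: (ma_meet_aeE a b) (ma_meet_aeE (a `&` b)%O b).
  by apply: filterS2 => w -> _ [].
apply/eqP/event_repr_inj; move: (ma_meet_aeE a b) ab.
apply: filterS2 => w eab ab _; apply/propext; rewrite eab.
by split=> [[]//|aw]; split; last exact: ab.
Qed.

Lemma ma_topP b : b = \top%O <-> {ae P, forall w, event_repr b w}.
Proof.
have tE : {ae P, forall w, event_repr (\top : measure_algebra P)%O w}.
  by apply: filterS (event_classE (@measurableT _ Omega)) => w ->.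
split=> [-> //|bT]; apply: le_anti; rewrite lex1 /=.
by apply/ma_leP; apply: filterS bT.
Qed.

Lemma ma_bot_ae : {ae P, forall w, ~ event_repr (\bot : measure_algebra P)%O w}.
Proof. by apply: filterS (event_classE (@measurable0 _ Omega)) => w ->. Qed.

Lemma L0_eq_event_ae d' (M : diagMeasurableType d') (xi eta : L0 P M) :
  {ae P, forall w, event_repr (L0_eq_event xi eta) w <->
    L0_repr xi w = L0_repr eta w}.
Proof. exact: event_classE. Qed.

Lemma L0_ae_eq d' (M : measurableType d') (xi eta : L0 P M) :
  {ae P, forall w, L0_repr xi w = L0_repr eta w} -> xi = eta.
Proof. by move=> h; apply: L0_repr_inj; apply: filterS h. Qed.

Lemma L0_eq_event_top d' (M : diagMeasurableType d') (xi eta : L0 P M) :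
  L0_eq_event xi eta = \top%O -> xi = eta.
Proof.
move=> /ma_topP h; apply: L0_ae_eq; move: h (L0_eq_event_ae xi eta).
by apply: filterS2 => w + <-.
Qed.

Lemma L0_eq_event_refl d' (M : diagMeasurableType d') (xi : L0 P M) :
  L0_eq_event xi xi = \top%O.
Proof.
by apply/ma_topP; apply: filterS (L0_eq_event_ae xi xi) => w ->.
Qed.

Lemma L0_eq_event_trans d' (M : diagMeasurableType d') (xi eta zeta : L0 P M) a :
  (a <= L0_eq_event xi eta)%O -> (a <= L0_eq_event eta zeta)%O ->
  (a <= L0_eq_event xi zeta)%O.
Proof.
move=> le1 le2; have : (a <= L0_eq_event xi eta `&` L0_eq_event eta zeta)%O.
  by rewrite lexI le1.
move/le_trans; apply; apply/ma_leP.
move: (ma_meet_aeE (L0_eq_event xi eta) (L0_eq_event eta zeta)).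
move: (L0_eq_event_ae xi eta) (L0_eq_event_ae eta zeta) (L0_eq_event_ae xi zeta).
move=> h1 h2 h3 h4; apply: filterS (aeI (aeI h1 h2) (aeI h3 h4)).
by move=> w [[e1 e2] [e3 e4]] /e4[/e1 x /e2 y]; apply/e3; rewrite x.
Qed.

Lemma ma_meets_ae (I : finType) (f : I -> measure_algebra P) :
  {ae P, forall w, (forall i, event_repr (f i) w) ->
    event_repr (\meet_i f i)%O w}.
Proof.
elim: (index_enum I) => [|i r IH]; rewrite ?big_nil ?big_cons.
  have /ma_topP : \top%O = \top%O :> measure_algebra P by [].
  by apply: filterS.
move: IH (ma_meet_aeE (f i) (\meet_(j <- r) f j)%O).
apply: filterS2 => w IH [_ h] fw.
by apply: h; split; [exact: fw|exact: IH].
Qed.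

Lemma L0_const_ae d' (M : measurableType d') (c : M) :
  {ae P, forall w, L0_repr (L0_const P c) w = c}.
Proof.
have := L0_reprE P (@measurable_cst _ _ Omega M setT c).
by apply: filterS => w; exact.
Qed.

Definition disjointify M (b : 'I_M -> measure_algebra P) (m : 'I_M) :=
  (b m `\` \join_(l < M | (l < m)%N) b l)%O.

Lemma disjointify_le M (b : 'I_M -> measure_algebra P) m :
  (disjointify b m <= b m)%O.
Proof. exact: leBx. Qed.

Lemma disjointify_partition M (b : 'I_M -> measure_algebra P) :
  (forall c, (forall m, (b m <= c)%O) -> c = \top%O) ->
  partition_of_unity (disjointify b).
Proof.
move=> bT; have disj (l m : 'I_M) : (l < m)%N ->
    (disjointify b l `&` disjointify b m = \bot)%O.
  move=> lm; apply: le_anti; rewrite le0x andbT.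
  have <- : ((\join_(i < M | (i < m)%N) b i) `&` disjointify b m)%O = \bot%O.
    exact: diffKI.
  apply: leI2 => //; apply: le_trans (disjointify_le b l) _.
  exact: joins_sup.
split=> [l m /eqP lm|c ac].
  have : (l != m :> nat) by [].
  rewrite neq_ltn => /orP[/disj //|/disj]; by rewrite meetC.
(* By strong induction, an upper bound of the disjoint parts is above each [b m], which is covered
   by its own part and the earlier events. *)
apply: bT => m; have [N] := ubnP (m : nat); elim: N m => // N IH m.
rewrite ltnS => mN; have := ac m; rewrite leBLR => /le_trans; apply.
rewrite leUx lexx andbT; apply/joinsP => l lm; apply: IH.
exact: leq_trans lm mN.
Qed.

End MeasureAlgebraTheory.

(** * Indicators, nonnegative elements and finite partitions *)

Section Indicators.
Context d (Omega : measurableType d) (R : realType) (P : probability Omega R)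
  (k : scalar_kind).
Local Notation K := (scalars R k).
Local Notation ma := (measure_algebra P).
Local Notation "'\I_' a" := (indicator k a) (at level 8, a at level 2).
Implicit Types (a b : ma) (xi eta : L0 P K).

Lemma indicator_ae a : {ae P, forall w,
  (event_repr a w /\ L0_repr \I_a w = 1) \/ (~ event_repr a w /\ L0_repr \I_a w = 0)}.
Proof.
have := L0_reprE P (@measurable_indicator _ _ R k _ (measurable_event_repr a)).
apply: filterS => w /(_ I) e; rewrite [L0_repr _ w]e.
case: ifPn => [/set_mem ?|/negP nw]; [by left|right].
by split=> // aw; apply: nw; apply: mem_set.
Qed.

Lemma indicator_mulP a xi eta :
  \I_a * xi = \I_a * eta <-> (a <= L0_eq_event xi eta)%O.
Proof.
have I := indicator_ae a; have Q := L0_eq_event_ae xi eta.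
have X := L0_mulE \I_a xi; have Y := L0_mulE \I_a eta.
split=> [e|/ma_leP le].
  rewrite e in X; apply/ma_leP; apply: filterS (aeI (aeI I Q) (aeI X Y)).
  move=> w [[Iw Qw] [-> /esym Yw]] aw; apply/Qw; move: Yw.
  by case: Iw => -[// _ ->]; rewrite !mul1r.
apply: L0_ae_eq; apply: filterS (aeI (aeI (aeI I Q) (aeI X Y)) le).
move=> w [[[Iw Qw] [-> ->]] lew].
by case: Iw => -[aw ->]; rewrite ?mul0r // (Qw.1 (lew aw)).
Qed.

Lemma indicator_top : \I_\top%O = 1 :> L0 P K.
Proof.
apply: L0_ae_eq; have /ma_topP T : \top%O = \top%O :> ma by [].
move: (indicator_ae \top%O) (L0_constE P (1 : K)) T.
by apply: filterS3 => w [[_ ->]|[]//] ->.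
Qed.

Lemma indicator_bot : \I_\bot%O = 0 :> L0 P K.
Proof.
apply: L0_ae_eq; move: (indicator_ae \bot%O) (L0_constE P (0 : K)) (ma_bot_ae P).
by apply: filterS3 => w [[]//|[_ ->]] ->.
Qed.

Lemma indicator_meet a b : \I_a * \I_b = \I_(a `&` b)%O :> L0 P K.
Proof.
apply: L0_ae_eq; move: (aeI (indicator_ae a) (indicator_ae b)).
move: (aeI (ma_meet_aeE a b) (indicator_ae (a `&` b)%O)).
move: (L0_mulE \I_a \I_b : {ae P, forall w, _}); apply: filterS3.
move=> w -> [ab abE] [aE bE].
case: abE => -[/ab h ->]; case: aE => -[aw ->]; case: bE => -[bw ->];
  rewrite ?mulr1 ?mulr0 ?mul0r //; by case: h.
Qed.

Lemma indicator_idem a : \I_a * \I_a = \I_a :> L0 P K.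
Proof. by rewrite indicator_meet meetxx. Qed.

Lemma indicator_nonneg a : L0_nonneg (\I_a : L0 P K).
Proof.
by rewrite /L0_nonneg /L0_in /=; apply: filterS (indicator_ae a) => w [] [_ ->] /=.
Qed.

Lemma L0_nonneg_const (c : K) : 0 <= c -> L0_nonneg (L0_const P c).
Proof. by move=> c0; apply: filterS (L0_constE P c) => w /= ->. Qed.

Lemma L0_nonneg_add xi eta :
  L0_nonneg xi -> L0_nonneg eta -> L0_nonneg (xi + eta).
Proof.
by apply: filterS3 (L0_addE xi eta) => w /= -> ? ?; exact: addr_ge0.
Qed.

Lemma L0_nonneg_mul xi eta :
  L0_nonneg xi -> L0_nonneg eta -> L0_nonneg (xi * eta).
Proof.
by apply: filterS3 (L0_mulE xi eta) => w /= -> ? ?; exact: mulr_ge0.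
Qed.

Lemma L0_nonneg_sum (I : Type) (r : seq I) (Q : pred I) (xi : I -> L0 P K) :
  (forall i, Q i -> L0_nonneg (xi i)) -> L0_nonneg (\sum_(i <- r | Q i) xi i).
Proof.
move=> h; elim/big_rec: _ => [|i x Qi]; first exact: L0_nonneg_const.
exact/L0_nonneg_add/h.
Qed.

Section Partition.
Context (M : nat) (a : 'I_M -> ma).
Context (aP : partition_of_unity a).

Lemma indicator_disjoint m l : m != l -> \I_(a m) * \I_(a l) = 0 :> L0 P K.
Proof.
by move=> /eqP/(proj1 aP) ml; rewrite indicator_meet ml indicator_bot.
Qed.

Lemma partition_eq xi eta :
  (forall m, \I_(a m) * xi = \I_(a m) * eta) -> xi = eta.
Proof.
move=> h; apply/L0_eq_event_top/(proj2 aP) => m.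
exact/indicator_mulP/h.
Qed.

Lemma indicator_sum (x : 'I_M -> L0 P K) m :
  \I_(a m) * (\sum_l \I_(a l) * x l) = \I_(a m) * x m.
Proof.
rewrite mulr_sumr (bigD1 m) //= mulrA indicator_idem big1 ?addr0 // => l lm.
by rewrite mulrA indicator_disjoint ?mul0r // eq_sym.
Qed.

Lemma indicator_scale_sum (E : lmodType (L0 P K)) (x : 'I_M -> E) m :
  \I_(a m) *: (\sum_l \I_(a l) *: x l) = \I_(a m) *: x m.
Proof.
rewrite scaler_sumr (bigD1 m) //= scalerA indicator_idem big1 ?addr0 // => l lm.
by rewrite scalerA indicator_disjoint ?scale0r // eq_sym.
Qed.

Lemma partition_sum1 : \sum_m \I_(a m) = 1 :> L0 P K.
Proof.
apply: partition_eq => m; rewrite mulr1 -[RHS]mulr1 -(indicator_sum (fun=> 1)).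
by congr (_ * _); apply: eq_bigr => l _; rewrite mulr1.
Qed.

(** Concatenation is stated for sequences: a finite partition is continued by [\bot] and a finite
    family of points by a default point. *)
Definition extend_nat (T : Type) (t0 : T) (f : 'I_M -> T) (i : nat) : T :=
  oapp f t0 (insub i).

Lemma extend_natE T (t0 : T) f (m : 'I_M) : extend_nat t0 f m = f m.
Proof. by rewrite /extend_nat valK. Qed.

Lemma partition_extend : partition_of_unity (extend_nat \bot%O a).
Proof.
split=> [i j ij|b ab].
  rewrite /extend_nat; case: insubP => [m _ mi|_]; last by rewrite meet0x.
  case: insubP => [l _ lj|_]; last by rewrite meetx0.
  by apply: (proj1 aP) => ml; apply: ij; rewrite -mi -lj ml.
by apply: (proj2 aP) => m; have := ab m; rewrite extend_natE.
Qed.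

Lemma is_concat_extend (E : lmodType (L0 P K)) (x : 'I_M -> E) x0 :
  is_concat (extend_nat \bot%O a) (extend_nat x0 x) (\sum_m \I_(a m) *: x m).
Proof.
move=> i; rewrite /extend_nat; case: insubP => [m _ _|_] /=.
  exact: indicator_scale_sum.
by rewrite indicator_bot !scale0r.
Qed.

End Partition.

End Indicators.

(** * Convex hulls, affine independence and extreme points *)

Section Hulls.
Context d (Omega : measurableType d) (R : realType) (P : probability Omega R)
  (k : scalar_kind) (E : lmodType (L0 P (scalars R k))).
Local Notation K := (scalars R k).
Implicit Types (D : set (L0 P K)) (H : set E).

Lemma mem_hull D H z : D 1 -> H z -> hull D H z.
Proof.
move=> D1 Hz; exists 1, (fun=> z), (fun=> 1).
by rewrite !big_ord1 scale1r.
Qed.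

Lemma hull_range D m (y : 'I_m -> E) xi : (forall i, D (xi i)) ->
  \sum_i xi i = 1 -> hull D (range y) (\sum_i xi i *: y i).
Proof. by move=> Dxi s1; exists m, y, xi; split=> // i; exists i. Qed.

(** The points of a combination may repeat: [f] assigns a vertex to each, and weights with the same
    vertex are added, which is why [D] contains 0 and is closed under sums. *)
Lemma hull_imageP D m (y : 'I_m -> E) (I : set 'I_m) z :
  D 0 -> (forall u v, D u -> D v -> D (u + v)) -> hull D (y @` I) z ->
  exists xi, [/\ forall i, D (xi i), forall i, ~ I i -> xi i = 0,
    \sum_i xi i = 1 & z = \sum_i xi i *: y i].
Proof.
move=> D0 DD [p [u [xi [yIu Dxi s1 ->]]]].
have /choice[f fP] i : exists l, I l /\ y l = u i.
  by have [l Il <-] := yIu i; exists l.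
exists (fun l => \sum_(i | f i == l) xi i); split.
- by move=> l; elim/big_rec: _ => // i v _; exact/DD.
- move=> l nIl; rewrite big_pred0 // => i; apply/eqP => e; apply: nIl.
  by rewrite -e; exact: (fP i).1.
- by rewrite -s1 (partition_big f xpredT).
rewrite (partition_big f xpredT) //=; apply: eq_bigr => l _.
rewrite scaler_suml; apply: eq_bigr => i /eqP <-.
by rewrite (fP i).2.
Qed.

Lemma sigma_hull_sum H z0 M (a : 'I_M -> measure_algebra P) (x : 'I_M -> E) :
  H z0 -> partition_of_unity a -> (forall m, H (x m)) ->
  sigma_hull H (\sum_m indicator k (a m) *: x m).
Proof.
move=> H0 aP Hx; exists (extend_nat \bot%O a), (extend_nat z0 x); split.
- exact: partition_extend.
- by move=> i; rewrite /extend_nat; case: insubP => [m _ _|_]; [exact: Hx|].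
- exact: is_concat_extend.
Qed.

Lemma mem_sigma_hull H z : H z -> sigma_hull H z.
Proof.
move=> Hz; pose a (_ : 'I_1) : measure_algebra P := \top%O.
have aP : partition_of_unity a.
  split=> [i j|b /(_ ord0)]; first by rewrite (ord1 i) (ord1 j).
  by rewrite le1x => /eqP.
have := sigma_hull_sum Hz aP (fun=> Hz).
by rewrite big_ord1 indicator_top scale1r.
Qed.

Section AffineIndependence.
Context (n : nat).
Implicit Type y : 'I_n.+1 -> E.

(** This form singles out no base vertex, so that uniqueness of coordinates, reordering and gluing
    become direct. *)
Lemma L0_affinely_independentP y : L0_affinely_independent y <->
  forall xi, \sum_i xi i = 0 -> \sum_i xi i *: y i = 0 -> forall i, xi i = 0.
Proof.
have shift xi : \sum_(i | i != ord0) xi i *: (y i - y ord0) =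
    \sum_i xi i *: y i - (\sum_i xi i) *: y ord0.
  rewrite scaler_suml -sumrB [RHS](bigD1 ord0) //= subrr add0r.
  by apply: eq_bigr => i _; rewrite scalerBr.
split=> [yi xi s0 sy i|h xi].
  have nz j : j != ord0 -> xi j = 0.
    by apply: yi; rewrite shift s0 sy scale0r subrr.
  case: (eqVneq i ord0) => [->|]; last exact: nz.
  by move: s0; rewrite (bigD1 ord0) //= big1 ?addr0.
rewrite shift => e0.
(* Subtracting the whole sum at [ord0] makes the total zero and leaves the other coefficients
   alone. *)
pose eta i := xi i - if i == ord0 then \sum_j xi j else 0.
have es : \sum_i eta i = 0.
  by rewrite /eta sumrB -big_mkcond big_pred1_eq subrr.
have ey : \sum_i eta i *: y i = 0.
  rewrite -[RHS]e0 /eta; under eq_bigr do rewrite scalerBl.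
  rewrite sumrB; congr (_ - _); move: (\sum_j xi j) => S.
  rewrite (bigD1 ord0) //= big1 ?addr0 //.
  by move=> i /negbTE ->; rewrite scale0r.
move=> i i0; have := h _ es ey i.
by rewrite /eta (negbTE i0) subr0.
Qed.

Lemma barycentric_uniq y xi eta : L0_affinely_independent y ->
  \sum_i xi i = \sum_i eta i -> \sum_i xi i *: y i = \sum_i eta i *: y i ->
  forall i, xi i = eta i.
Proof.
move=> /L0_affinely_independentP h s sy i.
apply/eqP; rewrite -subr_eq0; apply/eqP; move: i; apply: h.
  by rewrite sumrB s subrr.
by under eq_bigr do rewrite scalerBl; rewrite sumrB sy subrr.
Qed.

Lemma L0_affinely_independent_perm y (s : 'S_n.+1) :
  L0_affinely_independent y -> L0_affinely_independent (y \o s).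
Proof.
move=> /L0_affinely_independentP h; apply/L0_affinely_independentP => xi s0 sy i.
have := h (fun j => xi ((s^-1)%g j)) _ _ (s i); rewrite permK; apply.
  rewrite (reindex_inj (@perm_inj _ s)) -[RHS]s0.
  by apply: eq_bigr => j _; rewrite permK.
rewrite (reindex_inj (@perm_inj _ s)) -[RHS]sy.
by apply: eq_bigr => j _; rewrite permK.
Qed.

Lemma conv_L0_rangeP y z : conv_L0 (range y) z <->
  exists xi, [/\ forall i, L0_nonneg (xi i), \sum_i xi i = 1
    & z = \sum_i xi i *: y i].
Proof.
split=> [yz|[xi [xi0 s1 ->]]]; last exact: hull_range.
have [||xi [xi0 _ s1 ->]] := @hull_imageP (@L0_nonneg _ _ _ P k) _ _ _ _ _ _ yz.
- exact: L0_nonneg_const.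
- exact: L0_nonneg_add.
- by exists xi.
Qed.

Lemma convex_comb_eq0 (lambda xi eta : L0 P K) : L0_open01 lambda ->
  L0_nonneg xi -> L0_nonneg eta -> lambda * xi + (1 - lambda) * eta = 0 ->
  xi = 0 /\ eta = 0.
Proof.
move=> l01 xi0 eta0 e.
have H : {ae P, forall w, L0_repr xi w = 0 /\ L0_repr eta w = 0}.
  have h1 := L0_addE (lambda * xi) ((1 - lambda) * eta).
  have h2 := aeI (L0_mulE lambda xi) (L0_mulE (1 - lambda) eta).
  have h3 := aeI (L0_addE 1 (- lambda)) (L0_oppE lambda).
  have h4 := aeI (L0_constE P (0 : K)) (L0_constE P (1 : K)).
  rewrite e in h1.
  have h := aeI (aeI (aeI l01 xi0) eta0) (aeI (aeI h1 h2) (aeI h3 h4)).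
  apply: filterS h => w /=.
  move=> [[[/andP[l0 l1] x0] y0] [[s [m1 m2]] [[s' o] [z u]]]].
  move: s; rewrite m1 m2 s' o.
  have -> : L0_repr (0 : L0 P K) w = 0 by exact: z.
  have -> : L0_repr (1 : L0 P K) w = 1 by exact: u.
  have l1' : 0 < 1 - L0_repr lambda w by rewrite subr_gt0.
  move=> /esym/eqP; rewrite paddr_eq0 ?mulr_ge0 // ?(ltW l0) ?(ltW l1') //.
  by rewrite !mulf_eq0 (gt_eqF l0) (gt_eqF l1') => /andP[/eqP -> /eqP ->].
by split; apply: L0_ae_eq; move: H (L0_constE P (0 : K));
  apply: filterS2 => w [? ?] ->.
Qed.

(** Off [i] the coordinates of [y i] are 0, hence by [convex_comb_eq0] so are those of the two
    points combined. *)
Lemma vertex_ext y i : L0_affinely_independent y ->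
  ext_L0 (conv_L0 (range y)) (y i).
Proof.
move=> yi; split; first by apply: mem_hull; [exact: L0_nonneg_const|exists i].
move=> u v lambda /conv_L0_rangeP[xi [xi0 s1 ->]].
move=> /conv_L0_rangeP[eta [eta0 t1 ->]] l01 e.
have yE : y i = \sum_j (j == i)%:R *: y j.
  rewrite (bigD1 i) //= eqxx scale1r big1 ?addr0 // => j /negbTE ->.
  by rewrite scale0r.
have co j : lambda * xi j + (1 - lambda) * eta j = (j == i)%:R.
  move: j; apply: (barycentric_uniq yi).
    rewrite big_split /= -!mulr_sumr s1 t1 !mulr1 [lambda + _]addrC subrK.
    by rewrite (bigD1 i) //= eqxx big1 ?addr0 // => j /negbTE ->.
  rewrite -yE -e !scaler_sumr -big_split /=; apply: eq_bigr => j _.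
  by rewrite !scalerA scalerDl.
have z j : j != i -> xi j = 0 /\ eta j = 0.
  by move=> ji; apply: (convex_comb_eq0 l01); rewrite // co (negbTE ji).
have only (ze : 'I_n.+1 -> L0 P K) : (forall j, j != i -> ze j = 0) ->
    \sum_j ze j = 1 -> \sum_j ze j *: y j = y i.
  move=> z0; rewrite (bigD1 i) //= big1 // addr0 => s.
  by rewrite (bigD1 i) //= s scale1r big1 ?addr0 // => j /z0 ->; rewrite scale0r.
by split; apply: only => // j /z[].
Qed.

End AffineIndependence.
End Hulls.

(** * Real constants inside [L0] *)

Section RealConstants.
Context (R : realType).

Definition scalar_of_real (k : scalar_kind) : R -> scalars R k :=
  match k return R -> scalars R k with
  | RealScalars => id
  | ComplexScalars => real_complex R
  end.

Context (k : scalar_kind).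
Local Notation iota := (scalar_of_real k).

Lemma scalar_of_realB : {morph iota : x y / x - y}.
Proof. by case: k => // x y; exact: (rmorphB (real_complex R)). Qed.

Lemma scalar_of_realM : {morph iota : x y / x * y}.
Proof. by case: k => // x y; exact: (rmorphM (real_complex R)). Qed.

Lemma scalar_of_real1 : iota 1 = 1.
Proof. by case: k. Qed.

Lemma scalar_of_real_ge0 r : 0 <= r -> 0 <= iota r.
Proof. by case: k => //= r0; rewrite -[0]/(real_complex R 0) lecR. Qed.

(** A nonnegative element of [R[i]] has zero imaginary part, so the weights of the classical hull
    are real for both scalar fields. *)
Lemma ge0_scalar_of_real (c : scalars R k) :
  0 <= c -> exists2 r, 0 <= r & c = iota r.
Proof.
case: k c => [c c0|[a b]]; first by exists c.
by rewrite lecE /= => /andP[/eqP -> a0]; exists a.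
Qed.

Context d (Omega : measurableType d) (P : probability Omega R).

Definition L0_real (r : R) : L0 P (scalars R k) := L0_const P (iota r).

Lemma L0_real_inj : injective L0_real.
Proof.
move=> x y /L0_class_eqP [N [mN N0 sN]].
have [e|ne] := eqVneq (iota x) (iota y); last first.
  have NT : N = setT.
    by apply/seteqP; split => // w _; apply: sN => /= /(_ I)/eqP; apply/negP.
  by move: N0; rewrite NT probability_setT => /eqP; rewrite onee_eq0.
move: e; clear; case: k => //=; exact: complexI.
Qed.

Lemma L0_real_sub : {morph L0_real : x y / x - y}.
Proof.
move=> x y; apply: L0_ae_eq; have C r := L0_constE P (iota r).
apply: filterS (aeI (aeI (C (x - y)) (L0_addE (L0_real x) (- L0_real y)))
  (aeI (aeI (C x) (C y)) (L0_oppE (L0_real y)))).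
by move=> w [[-> ->] [[-> e] ->]]; rewrite scalar_of_realB [in RHS]e.
Qed.

Lemma L0_real_mul : {morph L0_real : x y / x * y}.
Proof.
move=> x y; apply: L0_ae_eq; have C r := L0_constE P (iota r).
apply: filterS (aeI (aeI (C (x * y)) (L0_mulE (L0_real x) (L0_real y)))
  (aeI (C x) (C y))).
by move=> w [[-> ->] [-> ->]]; rewrite scalar_of_realM.
Qed.

Lemma L0_real_monoid : monoid_morphism L0_real.
Proof.
by split; [rewrite /L0_real scalar_of_real1|exact: L0_real_mul].
Qed.

HB.instance Definition _ :=
  GRing.isZmodMorphism.Build R (L0 P (scalars R k)) L0_real L0_real_sub.
HB.instance Definition _ :=
  GRing.isMonoidMorphism.Build R (L0 P (scalars R k)) L0_real L0_real_monoid.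

End RealConstants.

(** * Constant barycentric coordinates of a subdivision *)

Section Coordinates.
Context d (Omega : measurableType d) (R : realType) (P : probability Omega R)
  (k : scalar_kind) (E : lmodType (L0 P (scalars R k))) (n : nat).
Local Notation pt := 'rV[R]_n.+1.
Local Notation e := (L0_real k P).
Local Notation conv := (@Defs.conv d Omega R P k E).
Implicit Types (x y : 'I_n.+1 -> E) (p q c : pt).

Definition comb x p : E := \sum_i e (p 0 i) *: x i.

Definition total p : R := \sum_i p 0 i.

Lemma total_mulmx c (A : 'M[R]_n.+1) :
  (forall i, total (row i A) = 1) -> total (c *m A) = total c.
Proof.
move=> A1; rewrite /total; under eq_bigr do rewrite mxE.
rewrite exchange_big; apply: eq_bigr => i _; rewrite -mulr_sumr.
have := A1 i; rewrite /total; under eq_bigr do rewrite mxE.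
by move=> ->; rewrite mulr1.
Qed.

Lemma totalZ t p : total (t *: p) = t * total p.
Proof. by rewrite mulr_sumr; apply: eq_bigr => i _; rewrite mxE. Qed.

Lemma comb_mulmx x y (A : 'M[R]_n.+1) c :
  (forall i, y i = comb x (row i A)) -> comb x (c *m A) = comb y c.
Proof.
move=> yE; rewrite /comb.
under eq_bigr do rewrite mxE rmorph_sum scaler_suml.
rewrite exchange_big; apply: eq_bigr => i _; rewrite yE scaler_sumr.
by apply: eq_bigr => j _; rewrite scalerA -rmorphM mxE.
Qed.

Lemma comb_inj x p q : L0_affinely_independent x ->
  total p = total q -> comb x p = comb x q -> p = q.
Proof.
move=> xi s pq; apply/rowP => i; apply: (@L0_real_inj _ k _ _ P).
by move: i; apply: (barycentric_uniq xi) => //; rewrite -!rmorph_sum -/(total p) s.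
Qed.

Lemma conv_imageP y (I : set 'I_n.+1) z : conv (y @` I) z ->
  exists p, [/\ forall i, 0 <= p 0 i, forall i, ~ I i -> p 0 i = 0,
    total p = 1 & z = comb y p].
Proof.
move=> yz; have [||xi [Dxi xi0 s1 ->]] := hull_imageP _ _ yz.
- by exists 0; [exact: lexx|].
- move=> _ _ [a a0 <-] [b b0 <-].
  have [r r0 ->] := ge0_scalar_of_real a0; have [t t0 ->] := ge0_scalar_of_real b0.
  exists (scalar_of_real k (r + t)); first exact/scalar_of_real_ge0/addr_ge0.
  exact: (rmorphD e).
have /choice[r rP] i : exists r, 0 <= r /\ e r = xi i.
  have [a a0 <-] := Dxi i; have [r r0 ->] := ge0_scalar_of_real a0.
  by exists r.
exists (\row_i r i); split.
- by move=> i; rewrite mxE (rP i).1.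
- by move=> i /xi0; rewrite mxE -(rP i).2 -(rmorph0 e) => /L0_real_inj.
- apply: (@L0_real_inj _ k _ _ P); rewrite rmorph_sum rmorph1 -s1.
  by apply: eq_bigr => i _; rewrite mxE -(rP i).2.
- by apply: eq_bigr => i _; rewrite mxE (rP i).2.
Qed.

Lemma conv_comb y p : (forall i, 0 <= p 0 i) -> total p = 1 ->
  conv (range y) (comb y p).
Proof.
move=> p0 p1; apply: hull_range; last by rewrite -rmorph_sum -/(total p) p1 rmorph1.
by move=> i; exists (scalar_of_real k (p 0 i)) => //; exact: scalar_of_real_ge0.
Qed.

Lemma conv_mem (H : set E) z : H z -> conv H z.
Proof. by apply: mem_hull; exists 1; [exact: ler01|]. Qed.

Lemma comb_vertex y i : comb y (delta_mx 0 i) = y i.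
Proof.
rewrite /comb (bigD1 i) //= mxE !eqxx rmorph1 scale1r big1 ?addr0 // => j.
by rewrite mxE eqxx => /negbTE ->; rewrite rmorph0 scale0r.
Qed.

Lemma total_delta i : total (delta_mx 0 i) = 1.
Proof.
rewrite /total (bigD1 i) //= mxE !eqxx big1 ?addr0 // => j.
by rewrite mxE eqxx => /negbTE ->.
Qed.

Section Subdivision.
Context (x : 'I_n.+1 -> E) (J : finType) (G : J -> 'I_n.+1 -> E).
Context (xind : L0_affinely_independent x).
Context (Gind : forall j, L0_affinely_independent (G j)).
Context (Gsub : simplicial_subdivision x G).

(** The covering of the classical simplex puts each vertex in the convex hull of [x] with constant
    weights, so the same matrices serve at every point of [Omega]. *)
Lemma vertex_coordinates : exists A : J -> 'M[R]_n.+1,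
  [/\ forall j i, G j i = comb x (row i (A j)),
      forall j i, total (row i (A j)) = 1
    & forall j i m, 0 <= A j i m].
Proof.
have [_ cov _] := Gsub.
have /choice[f fP] (q : J * 'I_n.+1) : exists p, [/\ forall m, 0 <= p 0 m,
    total p = 1 & G q.1 q.2 = comb x p].
  have : conv (range x) (G q.1 q.2).
    by rewrite cov; exists q.1 => //; apply: conv_mem; exists q.2.
  by move=> /conv_imageP[p [p0 _ p1 pE]]; exists p.
have fE j i : row i (\matrix_(l, m) f (j, l) 0 m) = f (j, i).
  by apply/rowP => m; rewrite !mxE.
exists (fun j => \matrix_(l, m) f (j, l) 0 m).
by split=> [j i|j i|j i m]; rewrite ?fE ?mxE; have [] := fP (j, i).
Qed.

Context (A : J -> 'M[R]_n.+1).
Context (AG : forall j i, G j i = comb x (row i (A j))).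
Context (A1 : forall j i, total (row i (A j)) = 1).

Let combG j c : comb (G j) c = comb x (c *m A j).
Proof. by rewrite (comb_mulmx _ (AG j)). Qed.

Let totalA j c : total (c *m A j) = total c.
Proof. exact: total_mulmx. Qed.

(** A row vector killed by [A j] has total 0 and combines the vertices of [G j] to 0, so their
    independence makes it 0. *)
Lemma coordinates_det j : \det (A j) != 0.
Proof.
apply/negP => /eqP/eqP/det0P[v v0 vA]; case/negP: v0; apply/eqP.
apply: (comb_inj (@Gind j)); last by rewrite !combG vA mul0mx.
by rewrite -(totalA j) vA.
Qed.

Let A_inj j c c' : c *m A j = c' *m A j -> c = c'.
Proof.
have u : A j \in unitmx by rewrite unitmxE unitfE coordinates_det.
by move=> /(congr1 (mulmx^~ (invmx (A j)))); rewrite !mulmxK.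
Qed.

Lemma coordinates_cover : subdivision_cover A.
Proof.
move=> p p_gt0; have s_gt0 : 0 < total p.
  rewrite /total (bigD1 ord0) //= ltr_pwDl // sumr_ge0 // => i _; exact: ltW.
have s0 := lt0r_neq0 s_gt0.
have q1 : total ((total p)^-1 *: p) = 1 by rewrite totalZ mulVf.
have : conv (range x) (comb x ((total p)^-1 *: p)).
  apply: conv_comb => // i; rewrite mxE mulr_ge0 ?invr_ge0 ?ltW //.
have [_ -> _] := Gsub => -[j _ /conv_imageP[c [c0 _ c1 ec]]].
exists j, (total p *: c); split; first by move=> i; rewrite mxE mulr_ge0 // ltW.
rewrite -scalemxAl -(comb_inj xind _ (etrans ec (combG j c))).
  by rewrite scalerA divff // scale1r.
by rewrite totalA c1.
Qed.

(* A vertex of A i carrying a weight lies in the common face, hence is a convex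
   combination of vertices of A j that lie in the cell A i; being extreme there,
   it is one of them. *)
Lemma coordinates_faces : subdivision_faces A.
Proof.
move=> i j c c' c0 c'0 cc' l cl.
have s_gt0 : 0 < total c.
  by rewrite /total (bigD1 l) //= ltr_pwDl // sumr_ge0.
pose t := (total c)^-1; have t_gt0 : 0 < t by rewrite invr_gt0.
have tc1 : total (t *: c) = 1 by rewrite totalZ mulVf // gt_eqF.
have Z0 q : (forall m, 0 <= q 0 m) -> forall m, 0 <= (t *: q) 0 m.
  by move=> q0 m; rewrite mxE mulr_ge0 // ltW.
have tc'1 : total (t *: c') = 1.
  by rewrite -(totalA j) -scalemxAl -cc' scalemxAl totalA.
have Fi : conv (range (G i)) (comb (G i) (t *: c)).
  by apply: conv_comb => //; exact: Z0.
have Fj : conv (range (G j)) (comb (G i) (t *: c)).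
  rewrite combG -scalemxAl cc' scalemxAl -combG.
  by apply: conv_comb => //; exact: Z0.
have [_ _ /(_ i j) /=] := Gsub.
case=> [F0|[[I [_ FI]] [I' [_ FI']]]].
  by have : set0 (comb (G i) (t *: c)) by rewrite -F0.
have /conv_imageP[b [_ bI b1 be]] : conv (G i @` [set` I]) (comb (G i) (t *: c)).
  by rewrite -FI.
have lI : l \in I.
  apply: contraT => /negP/bI; rewrite -(comb_inj (@Gind i) _ be) ?b1 // mxE.
  by move=> /eqP; rewrite mulf_eq0 !gt_eqF.
have : conv (G j @` [set` I']) (G i l).
  by rewrite -FI' FI; apply: conv_mem; exists l.
move=> /conv_imageP[a [a0 aI' a1 ea]].
have /existsP[m am] : [exists m, a 0 m != 0].
  apply: contraT; rewrite negb_exists => /forallP z.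
  have : total a = 0 by apply: big1 => m _; apply/eqP; have := z m; rewrite negbK.
  by rewrite a1 => /eqP; rewrite oner_eq0.
have Gji h : a 0 h != 0 ->
    exists2 b' : pt, (forall r, 0 <= b' 0 r) & row h (A j) = b' *m A i.
  move=> ah; have hI' : h \in I'.
    by apply: contraT => /negP/aI' z; rewrite z eqxx in ah.
  have : conv (range (G i)) (G j h).
    suff : conv (range (G i)) `&` conv (range (G j)) `<=` conv (range (G i)).
      by apply; rewrite FI'; apply: conv_mem; exists h.
    exact: subIsetl.
  move=> /conv_imageP[b' [b'0 _ b'1 eb']]; exists b' => //.
  apply: (comb_inj xind); first by rewrite totalA b'1.
  by rewrite -AG -combG.
(* [B h] holds the coordinates in the cell [i] of a vertex of [A j] with nonzero weight in [a]; for
   the other vertices the weight is 0 and any value will do. *)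
have /choice[B BP] h : exists b' : pt, a 0 h != 0 ->
    (forall r, 0 <= b' 0 r) /\ row h (A j) = b' *m A i.
  have [_|/Gji[b' b'0 eb']] := eqVneq (a 0 h) 0; first by exists 0.
  by exists b'.
have eA : delta_mx 0 l *m A i = a *m A j.
  apply: (comb_inj xind); first by rewrite !totalA total_delta a1.
  by rewrite -!combG comb_vertex.
(* In coordinates of the cell [i], the vertex [l] is a combination of the [B h]. Its zero
   coordinates are sums of nonnegative terms, so [B m] vanishes off [l]. *)
have eB : delta_mx 0 l = \sum_h a 0 h *: B h.
  apply: (@A_inj i); rewrite eA mulmx_sum_row mulmx_suml; apply: eq_bigr => h _.
  have [->|/BP[_ eh]] := eqVneq (a 0 h) 0; first by rewrite !scale0r mul0mx.
  by rewrite eh scalemxAl.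
exists m; have [B0 ->] := BP m am; rewrite [RHS]rowE; congr (_ *m _).
have Bm (q : 'I_n.+1) : q != l -> B m 0 q = 0.
  move=> ql; have /rowP/(_ q)/esym/eqP := eB.
  rewrite mxE eqxx (negbTE ql) summxE psumr_eq0 => [|h _]; last first.
    rewrite mxE; have [->|/BP[z _]] := eqVneq (a 0 h) 0; first by rewrite mul0r.
    by rewrite mulr_ge0.
  move=> /allP/(_ m (mem_index_enum _)); rewrite mxE mulf_eq0 (negbTE am).
  by move=> /eqP.
have B1 : total (B m) = 1 by rewrite -(totalA i) -(BP m am).2 A1.
apply/rowP => q; rewrite mxE eqxx; have [->|/Bm] := eqVneq q l; last by [].
by rewrite -[LHS]addr0 -B1 /total (bigD1 l) //= big1.
Qed.

End Subdivision.
End Coordinates.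

(** * Gluing simplexes along a finite partition *)

Section Gluing.
Context d (Omega : measurableType d) (R : realType) (P : probability Omega R)
  (k : scalar_kind) (E : lmodType (L0 P (scalars R k))) (n M : nat)
  (a : 'I_M -> measure_algebra P) (y : 'I_M -> 'I_n.+1 -> E).
Context (aP : partition_of_unity a).
Local Notation "'\I_' a" := (indicator k a) (at level 8, a at level 2).
Let z j := \sum_m \I_(a m) *: y m j.

Let zE m j : \I_(a m) *: z j = \I_(a m) *: y m j.
Proof. exact: indicator_scale_sum. Qed.

(** Multiplied by [\I_(a m)], a relation among the glued vertices becomes one among those of [y m],
    so the coefficients vanish on each piece. *)
Lemma L0_affinely_independent_glue :
  (forall m, L0_affinely_independent (y m)) -> L0_affinely_independent z.
Proof.
move=> yind; apply/L0_affinely_independentP => xi s0 sz i.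
apply: (partition_eq aP) => m; rewrite mulr0; move: i.
apply: (iffLR (L0_affinely_independentP (y m)) (@yind m)).
  by rewrite -mulr_sumr s0 mulr0.
rewrite -[RHS](scaler0 _ \I_(a m)) -[in RHS]sz scaler_sumr.
apply: eq_bigr => i _.
by rewrite mulrC -scalerA -zE !scalerA mulrC.
Qed.

(** Weights chosen on each piece are glued along the same partition; conversely, one family of
    weights is used on every piece. *)
Lemma finite_concat_conv_L0 :
  finite_concat a (fun m => conv_L0 (range (y m))) = conv_L0 (range z).
Proof.
apply/seteqP; split=> u.
  move=> [v [vC ->]].
  have /choice[xi xiP] m : exists xi, [/\ forall i, L0_nonneg (xi i),
      \sum_i xi i = 1 & v m = \sum_i xi i *: y m i].
    exact/conv_L0_rangeP.
  apply/conv_L0_rangeP; exists (fun i => \sum_m \I_(a m) * xi m i); split.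
  - move=> i; apply: L0_nonneg_sum => m _; apply: L0_nonneg_mul.
      exact: indicator_nonneg.
    by have [] := xiP m.
  - rewrite exchange_big -[RHS](partition_sum1 k aP); apply: eq_bigr => m _.
    by rewrite -mulr_sumr; have [_ -> _] := xiP m; rewrite mulr1.
  - under [RHS]eq_bigr do rewrite scaler_suml.
    rewrite exchange_big; apply: eq_bigr => m _.
    have [_ _ ->] := xiP m; rewrite scaler_sumr; apply: eq_bigr => i _.
    by rewrite mulrC -[RHS]scalerA zE !scalerA mulrC.
move=> /conv_L0_rangeP[xi [xi0 s1 ->]].
exists (fun m => \sum_i xi i *: y m i); split=> [m|].
  by apply/conv_L0_rangeP; exists xi.
under [RHS]eq_bigr do rewrite scaler_sumr.
rewrite exchange_big; apply: eq_bigr => i _; rewrite scaler_sumr.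
by apply: eq_bigr => m _; rewrite !scalerA mulrC.
Qed.

End Gluing.

(** * Sperner's lemma at almost every point *)

Section PointwiseSperner.
Context d (Omega : measurableType d) (R : realType) (P : probability Omega R)
  (k : scalar_kind) (E : lmodType (L0 P (scalars R k))) (n : nat)
  (x : 'I_n.+1 -> E) (J : finType) (G : J -> 'I_n.+1 -> E)
  (phi : E -> L0 P 'I_n.+1).
Context (xind : L0_affinely_independent x).
Context (Gsub : L0_simplicial_subdivision x G).

Lemma vertex_ext_subdivision j i : ext_subdivision G (G j i).
Proof.
have [Gind _ _ _] := Gsub; apply: mem_sigma_hull.
by exists j => //; exact/vertex_ext/Gind.
Qed.

(** The cell found supplies the default vertex with which finite families are completed to
    sequences. *)
Lemma subdivision_inhabited : exists j : J, True.
Proof.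
have [_ _ _ [_ cov _]] := Gsub.
have : Defs.conv (range x) (x ord0) by apply: conv_mem; exists ord0.
by rewrite cov => -[j _ _]; exists j.
Qed.

Lemma sperner_ae : proper_L0_labeling x G phi ->
  {ae P, forall w, exists j (s : 'S_n.+1), forall m, L0_repr (phi (G j (s m))) w = m}.
Proof.
move=> [_ phiP]; have [Gind _ _ Gs] := Gsub.
have [A [AG A1 A0]] := vertex_coordinates Gs.
have proper_ae : {ae P, forall w, forall q : J * 'I_n.+1 * 'I_n.+1,
    A q.1.1 q.1.2 q.2 = 0 -> L0_repr (phi (G q.1.1 q.1.2)) w <> q.2}.
  apply: filter_forall => -[[j i] m] /=.
  have [A0jim|Ane] := pselect (A j i m = 0); last first.
    by apply: nearW => w.
  have b0 : L0_eq_event (phi (G j i)) (L0_const P m) = \bot%O.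
    have lm : L0_real k P (A j i m) = 0 by rewrite A0jim rmorph0.
    (* The coordinate being 0, the event on which it vanishes is [\top], so properness makes the
       event of the label [m] itself [\bot]. *)
    rewrite -[LHS]meetx1 -(L0_eq_event_refl (0 : L0 P (scalars R k))) -{1}lm.
    apply: (phiP (G j i) (fun l => L0_real k P (A j i l))).
    - exact: vertex_ext_subdivision.
    - by move=> l; exact/L0_nonneg_const/scalar_of_real_ge0.
    - rewrite -rmorph_sum -[RHS](rmorph1 (L0_real k P)) -(A1 j i).
      by congr (L0_real k P _); apply: eq_bigr => l _; rewrite mxE.
    - by rewrite AG; apply: eq_bigr => l _; rewrite mxE.
  have := L0_eq_event_ae (phi (G j i)) (L0_const P m); rewrite b0 => b.
  apply: filterS (aeI (aeI b (ma_bot_ae P)) (L0_const_ae P m)).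
  by move=> w [[bw nb] cw] _ e; apply/nb/bw; rewrite cw.
apply: filterS proper_ae => w wP.
have [||||||j [s h]] := @sperner R n J A (fun p => L0_repr (phi (comb x p)) w).
- exact: (coordinates_det Gind AG A1).
- by move=> j i; rewrite -[RHS](A1 j i); apply: eq_bigr => m _; rewrite mxE.
- exact: A0.
- exact: (coordinates_cover xind Gs AG A1).
- exact: (coordinates_faces xind Gind Gs AG A1).
- move=> j i; rewrite -AG; apply/eqP => /(wP (j, i, _)); exact.
- by exists j, s => m; rewrite AG h.
Qed.

End PointwiseSperner.

Theorem theorem2p9 (d : measure_display) (Omega : measurableType d)
    (R : realType) (P : probability Omega R) (k : scalar_kind)
    (E : lmodType (L0 P (scalars R k))) (n : nat) (x : 'I_n.+1 -> E)
    (J : finType) (G : J -> 'I_n.+1 -> E) (phi : E -> L0 P 'I_n.+1) :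
  regular E ->
  L0_affinely_independent x ->
  L0_simplicial_subdivision x G ->
  proper_L0_labeling x G phi ->
  exists (M : nat) (y : 'I_M -> 'I_n.+1 -> E) (a : 'I_M -> measure_algebra P),
    let z := fun j : 'I_n.+1 =>
      \sum_(m < M) indicator k (a m) *: y m j in
    [/\ forall m, simplex_in G (y m),
        partition_of_unity a,
        finite_concat a (fun m => conv_L0 (range (y m))) = conv_L0 (range z),
        L0_affinely_independent z /\ completely_labeled x G phi z
      & forall j, phi (z j) = L0_const P j].
Proof.
move=> _ xind Gsub phiP; have [Gind _ _ _] := Gsub.
have [j0 _] := subdivision_inhabited Gsub.
(* An index [m] encodes a cell with an ordering of its vertices, and [b m] is the event on which
   their labels are 0, ..., n in that order. *)
pose T : finType := (J * 'S_n.+1)%type.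
pose y (m : 'I_#|T|) i := G (enum_val m).1 ((enum_val m).2 i).
pose b (m : 'I_#|T|) := (\meet_i L0_eq_event (phi (y m i)) (L0_const P i))%O.
(* By [sperner_ae] almost every point lies in some [b m]; only finitely many null sets are
   discarded. *)
have b_top c : (forall m, (b m <= c)%O) -> c = \top%O.
  move=> bc; apply/ma_topP.
  have bc_ae : {ae P, forall w, forall m, event_repr (b m) w -> event_repr c w}.
    by apply: filter_forall => m; exact/ma_leP.
  have b_ae : {ae P, forall w, forall m,
      (forall i, L0_repr (phi (y m i)) w = i) -> event_repr (b m) w}.
    apply: filter_forall => m.
    have e_ae : {ae P, forall w, forall i, L0_repr (phi (y m i)) w = i ->
        event_repr (L0_eq_event (phi (y m i)) (L0_const P i)) w}.
      apply: filter_forall => i.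
      move: (L0_const_ae P i) (L0_eq_event_ae (phi (y m i)) (L0_const P i)).
      by apply: filterS2 => w cw ew h; apply/ew; rewrite h cw.
    move: e_ae (ma_meets_ae (fun i => L0_eq_event (phi (y m i)) (L0_const P i))).
    by apply: filterS2 => w ew bw h; apply: bw => i; exact/ew.
  apply: filterS3 bc_ae b_ae (sperner_ae xind Gsub phiP) => w bcw bw [j [s js]].
  apply: (bcw (enum_rank (j, s))); apply: bw => i.
  by rewrite /y enum_rankK.
pose a := disjointify b; have aP : partition_of_unity a.
  exact: disjointify_partition.
have ab m i : (a m <= L0_eq_event (phi (y m i)) (L0_const P i))%O.
  by apply: le_trans (disjointify_le b m) _; exact: meets_inf.
pose z j := \sum_(m < #|T|) indicator k (a m) *: y m j.
have y_ext m j : ext_subdivision G (y m j) by exact: (vertex_ext_subdivision Gsub).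
have z_ext j : ext_subdivision G (z j).
  apply: (@sigma_hull_sum _ _ _ _ _ _ _ (G j0 ord0)) => //.
    by exists j0 => //; exact/vertex_ext/Gind.
  by move=> m; exists (enum_val m).1 => //; exact/vertex_ext/Gind.
(* On [a m] the stability of [phi] gives [z j] the label of [y m j], which is [j] there. *)
have phi_z j : phi (z j) = L0_const P j.
  apply/L0_eq_event_top/(proj2 aP) => m.
  apply: L0_eq_event_trans (ab m j).
  pose y' := extend_nat (G j0 ord0) (y^~ j).
  have := phiP.1 (extend_nat \bot%O a) y' (z j) (partition_extend aP) _
    (z_ext j) (is_concat_extend aP _ _) m.
  rewrite /y' !extend_natE; apply => i; rewrite /extend_nat.
  by case: insubP => [l _ _|_] /=; exact: (vertex_ext_subdivision Gsub).
have yind m : L0_affinely_independent (y m).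
  exact: (@L0_affinely_independent_perm _ _ _ _ _ _ _ (G (enum_val m).1)).
exists #|T|, y, a; split=> //.
- move=> m; split=> //; exists (enum_val m).1.
  apply/seteqP; split=> _ [i _ <-]; first by exists ((enum_val m).2 i).
  by exists ((enum_val m).2^-1%g i) => //; rewrite /y permKV.
- exact: finite_concat_conv_L0.
- split; first exact: L0_affinely_independent_glue.
  split=> //; apply/seteqP; split=> _ [i _ <-]; exists i => //.
    exact/esym/phi_z.
  exact: phi_z.
Qed.
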